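(* Let $x$ be a rational number between $0$ and $1$ such that $\mathfrak p_x=\sqrt{\frac{(1+x)(1+3x)}{3}}$ is not rational. Consider perturbations of the configuration $C_{6,x}$ of six tangent lines to the unit sphere, as described in the context. (i) There exists a choice of the normalization constants $\vartheta_\varkappa,\vartheta_\varphi,\vartheta_\delta$ such that the Taylor coefficients of the squares of distances (between the lines of the perturbed configuration) belong to $\mathbb Q[\mathfrak p_x]$. (ii) The operator $\Pi_\varsigma=\iota\circ\Pi^\circ_\varsigma$, where $\iota$ is the Galois conjugation $\mathfrak p_x\mapsto-\mathfrak p_x$ of $\mathbb Q[\mathfrak p_x]$, restores the $\mathbb D_6$ symmetry.
   Context: Tangent lines. A point of the unit sphere $\mathbb S^2\subset\mathbb R^3$ is written $(\varphi,\varkappa)$ with latitude $\varphi$ and longitude $\varkappa$. For $p\in\mathbb S^2$ different from the poles, $[p,\uparrow_\delta]$ denotes the line tangent to $\mathbb S^2$ at $p$ whose direction is obtained from the unit tangent vector at $p$ pointing North by the rotation by the angle $\delta$ about the axis from the origin to $p$, counterclockwise when viewed from its tip. For angles $(\varkappa,\varphi,\delta)$ put $$A=[(\varphi,\tfrac{\pi}{6}-\varkappa),\uparrow_\delta],\quad B=[(\varphi,\tfrac{5\pi}{6}-\varkappa),\uparrow_\delta],\quad C=[(\varphi,\tfrac{3\pi}{2}-\varkappa),\uparrow_\delta],$$ $$D=[(-\varphi,\tfrac{\pi}{2}+\varkappa),\uparrow_\delta],\quad E=[(-\varphi,\tfrac{7\pi}{6}+\varkappa),\uparrow_\delta],\quad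 F=[(-\varphi,\tfrac{11\pi}{6}+\varkappa),\uparrow_\delta],$$ written $J(\varkappa,\varphi,\delta)$ for $J\in\{A,B,C,D,E,F\}$. For $\varkappa=\varphi=\delta=0$ this is the configuration $C_6$ of six vertical lines touching the sphere at the vertices of a regular hexagon on the equator. The configuration $C_{6,x}$ consists of the six lines $J(\varkappa(x),\varphi(x),\delta(x))$, where $$\sin\varphi(x)=2\sqrt{\frac{(1-x)x(1+x)}{1+7x+4x^2}},\quad \tan\delta(x)=\sqrt{\frac{(1-x)(1+3x)}{x(1+7x+4x^2)}},\quad \tan\varkappa(x)=\frac{x-1}{\sqrt{(1+x)(1+3x)}}.$$ Perturbations. The perturbed position of a line $J$ is $J(\varkappa(x)+\Delta_J^\varkappa,\varphi(x)+\Delta_J^\varphi,\delta(x)+\Delta_J^\delta)$ with $$\Delta_J^{\upsilon}=\vartheta_\upsilon\cdot\left(J_{\upsilon,1}t+J_{\upsilon,2}t^2+o(t^2)\right),\qquad \upsilon\in\{\varkappa,\varphi,\delta\},$$ where $\vartheta_\varkappa,\vartheta_\varphi,\vartheta_\delta$ are normalization constants. To fix the rotational symmetry the line $A$ is kept in place: $A_{\varkappa,j}=A_{\varphi,j}=A_{\delta,j}=0$ for $j=1,2,\dots$. The squares of the pairwise distances between the perturbed lines are expanded in Taylor series in $t$; the coefficients of these expansions are polynomial expressions in the parameters $J_{\upsilon,j}$, and the ''Taylor coefficients'' are the numerical coefficients of these expressions. Operators. They act on expressions in the symbols $J_\upsilon$ ($J\in\{A,\dots,F\}$, $\upsilon\in\{\varkappa,\varphi,\delta\}$)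 with coefficients in $\mathbb Q[\mathfrak p_x]$; e.g. the first differentials of the squared distances are regarded as elements of $\mathbb Q[\mathfrak p_x]\otimes_{\mathbb Q}\mathcal W$, where $\mathcal W$ is the $\mathbb Q$-vector space with basis $\{J_\upsilon\}$ (the terms with $J=A$ are absent from explicit formulas only because of the convention that $A$ is fixed). Let $\varsigma=(B,C)(D,F)$, fixing $A$ and $E$, and let $\Pi^\circ_\varsigma$ be given by $$J_\varkappa\mapsto-\varsigma(J)_\varkappa,\qquad J_\varphi\mapsto\varsigma(J)_\varphi,\qquad J_\delta\mapsto-\varsigma(J)_\delta;$$ $\iota$ acts on the coefficients. Let $\Pi_\varpi$ and $\Pi_\varrho$ be the operators realizing the permutations $\varpi=(A,B,C)(D,E,F)$ and $\varrho=(A,D)(B,F)(C,E)$ of the letters. Meaning of ''restores the $\mathbb D_6$ symmetry''. The configuration $C_{6,x}$ has the geometric symmetry group $\mathbb D_3$ (of order 6), reflected in the operators $\Pi_\varpi,\Pi_\varrho$, which generate $\mathbb D_3$ and preserve the collection of expressions for the expansions of the squared distances. The phrase refers to the fact that $\Pi_\varsigma$ preserves this collection as well (sending the expressions for the triplet of pairs $\{AF,CE,BD\}$ to those for $\{CF,BE,AD\}$ and permuting those for the six pairs $\{AB,BC,CA,DE,EF,FD\}$), and that the group generated by $\Pi_\varpi,\Pi_\varrho,\Pi_\varsigma$ is the dihedral group $\mathbb D_6$ (of order 12), whose underlying permutations of the lines form the symmetry group $\mathbb D_6$ of the configuration $C_6$. *)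

(* Defs.v *)
(* [monalg] has to be imported before the analysis files (notation levels). *)
From HB Require Import structures.
From mathcomp Require Import all_boot all_order all_algebra all_fingroup.
From mathcomp Require Import all_solvable finmap monalg.
From mathcomp Require Import boolp classical_sets reals topology normedtype.
From mathcomp Require Import landau trigo.

Set Implicit Arguments.
Unset Strict Implicit.
Unset Printing Implicit Defensive.

Import Order.TTheory GRing.Theory Num.Theory numFieldNormedType.Exports.

Local Open Scope classical_set_scope.
Local Open Scope ring_scope.

Variant letter := lA | lB | lC | lD | lE | lF.

Definition letter_code (J : letter) : nat :=
  match J with lA => 0 | lB => 1 | lC => 2 | lD => 3 | lE => 4 | lF => 5 end.

Definition letter_decode (n : nat) : option letter :=
  nth None [seq Some J | J <- [:: lA; lB; lC; lD; lE; lF]] n.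

Lemma letter_codeK : pcancel letter_code letter_decode.
Proof. by case. Qed.

HB.instance Definition _ := Countable.copy letter (pcan_type letter_codeK).

Lemma letter_enumP : Finite.axiom [:: lA; lB; lC; lD; lE; lF].
Proof. by case. Qed.

HB.instance Definition _ := isFinite.Build letter letter_enumP.

(* The three angles: longitude shift, latitude, direction. *)
Variant angle := Kap | Phi | Del.

Definition angle_code (u : angle) : nat :=
  match u with Kap => 0 | Phi => 1 | Del => 2 end.

Definition angle_decode (n : nat) : option angle :=
  nth None [seq Some u | u <- [:: Kap; Phi; Del]] n.

Lemma angle_codeK : pcancel angle_code angle_decode.
Proof. by case. Qed.

HB.instance Definition _ := Countable.copy angle (pcan_type angle_codeK).

(* [(J, u, j)] stands for the symbol J_{u, j+1}: there is no J_{u,0}. *)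
Definition symbol : choiceType := (letter * angle * nat)%type.

Section Geometry.
Context {R : realType}.
Implicit Types (phi kap del x : R).

Definition vec3 (a b c : R) : 'rV[R]_3 := \row_(j < 3) [:: a; b; c]`_j.

(* Latitude [phi], longitude [kap]. *)
Definition sphere_point phi kap :=
  vec3 (cos phi * cos kap) (cos phi * sin kap) (sin phi).

Definition north phi kap :=
  vec3 (- (sin phi * cos kap)) (- (sin phi * sin kap)) (cos phi).

(* [west kap] is the cross product of [sphere_point phi kap] and
   [north phi kap], that is, the image of North under the quarter turn about
   the outward normal, counterclockwise when seen from outside. *)
Definition west kap := vec3 (sin kap) (- cos kap) 0.

Definition tangent_line phi kap del : set 'rV[R]_3 :=
  [set sphere_point phi kap
       + s *: (cos del *: north phi kap + sin del *: west kap) | s in setT].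

(* The library norm on ['rV[R]_3] is the sup norm. *)
Definition eucl_norm (v : 'rV[R]_3) : R := Num.sqrt (\sum_(j < 3) v 0 j ^+ 2).

Definition line_dist (L M : set 'rV[R]_3) : R :=
  inf [set eucl_norm (u - v) | u in L & v in M].

Definition config_line (J : letter) kap phi del : set 'rV[R]_3 :=
  match J with
  | lA => tangent_line phi (pi / 6 - kap) del
  | lB => tangent_line phi (5 * pi / 6 - kap) del
  | lC => tangent_line phi (3 * pi / 2 - kap) del
  | lD => tangent_line (- phi) (pi / 2 + kap) del
  | lE => tangent_line (- phi) (7 * pi / 6 + kap) del
  | lF => tangent_line (- phi) (11 * pi / 6 + kap) del
  end.

Definition C6 (J : letter) := config_line J 0 0 0.

(* The angles kappa(x), phi(x), delta(x) of the configuration C_{6,x}; all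
   three are taken in the interval between -pi/2 and pi/2. *)
Definition base_angle x (u : angle) : R :=
  match u with
  | Kap => atan ((x - 1) / Num.sqrt ((1 + x) * (1 + 3 * x)))
  | Phi => asin (2 * Num.sqrt ((1 - x) * x * (1 + x)
                               / (1 + 7 * x + 4 * x ^+ 2)))
  | Del => atan (Num.sqrt ((1 - x) * (1 + 3 * x)
                           / (x * (1 + 7 * x + 4 * x ^+ 2))))
  end.

(* A perturbation of order N: the angle u of the line J is
     u(x) + theta_u * (J_{u,1} t + ... + J_{u,N} t^N + o(t^N)),
   where [par J u j] is the value of J_{u,j+1} and [rem J u] is the o(t^N). *)
Definition perturbed_angle x (theta : angle -> R)
    (par : letter -> angle -> nat -> R) (rem : letter -> angle -> R -> R)
    (N : nat) (J : letter) (t : R) (u : angle) : R :=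
  base_angle x u
  + theta u * (\sum_(j < N) par J u j * t ^+ j.+1 + rem J u t).

Definition perturbed_line x theta par rem N J t : set 'rV[R]_3 :=
  let a := perturbed_angle x theta par rem N J t in
  config_line J (a Kap) (a Phi) (a Del).

Definition sqdist x theta par rem N (J K : letter) (t : R) : R :=
  line_dist (perturbed_line x theta par rem N J t)
            (perturbed_line x theta par rem N K t) ^+ 2.

Definition keeps_A (par : letter -> angle -> nat -> R)
    (rem : letter -> angle -> R -> R) : Prop :=
  (forall u j, par lA u j = 0) /\ (forall u t, rem lA u t = 0).

(* Permutations of the lines induced by the isometries of the unit sphere. *)
Definition C6_symmetry (s : {perm letter}) : Prop :=
  exists2 g : 'M[R]_3, g *m g^T = 1%:M
    & forall J, [set v *m g | v in C6 J] = C6 (s J).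

Definition Qadjoin (p : R) : {pred R} :=
  fun r => `[< exists f : {poly rat}, r = (map_poly ratr f).[p] >].

Lemma Qadjoin_subring (p : R) : GRing.subring_closed (Qadjoin p).
Proof.
split=> [|r s /asboolP[f ->] /asboolP[g ->]|r s /asboolP[f ->] /asboolP[g ->]].
- by apply/asboolP; exists 1; rewrite rmorph1 hornerC.
- by apply/asboolP; exists (f - g); rewrite rmorphB hornerD hornerN.
- by apply/asboolP; exists (f * g); rewrite rmorphM hornerM.
Qed.

HB.instance Definition _ (p : R) :=
  GRing.isSubringClosed.Build R (Qadjoin p) (Qadjoin_subring p).

Record Qring (p : R) := QRing { Qval : R; _ : Qval \in Qadjoin p }.

HB.instance Definition _ (p : R) := [isSub for @Qval p].
HB.instance Definition _ (p : R) := [Choice of Qring p by <:].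
HB.instance Definition _ (p : R) :=
  [SubChoice_isSubComNzRing of Qring p by <:].

Lemma Qadjoin_gen (p : R) : p \in Qadjoin p.
Proof. by apply/asboolP; exists 'X; rewrite map_polyX hornerX. Qed.

Definition Qgen (p : R) : Qring p := QRing (Qadjoin_gen p).

Definition px (x : R) : R := Num.sqrt ((1 + x) * (1 + 3 * x) / 3).

End Geometry.

Definition monom_at (S : comNzRingType) (h : symbol -> S)
    (m : {cmonom symbol}) : S :=
  \prod_(s <- finsupp m) h s ^+ m s.

Section Expressions.
Context {R : realType} (p : R).

Definition expr : comNzRingType := {malg (Qring p)[{cmonom symbol}]}.

Definition symb (J : letter) (u : angle) (j : nat) : expr :=
  << ucm ((J, u, j) : symbol) >>.

Definition eval_expr (par : letter -> angle -> nat -> R) (e : expr) : R :=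
  mmap (val : Qring p -> R)
    (monom_at (fun s : symbol => let: (J, u, j) := s in par J u j)) e.

Definition subst_expr (iota : Qring p -> Qring p)
    (h : letter -> angle -> nat -> expr) (e : expr) : expr :=
  mmap ((fun c : Qring p => c%:MP : expr) \o iota)
    (monom_at (fun s : symbol => let: (J, u, j) := s in h J u j)) e.

Definition erase_A : expr -> expr :=
  subst_expr idfun (fun J u j => if J == lA then 0 else symb J u j).

Definition Pi_perm (s : {perm letter}) : expr -> expr :=
  subst_expr idfun (fun J u j => symb (s J) u j).

Definition Pi_circ (s : {perm letter}) : expr -> expr :=
  subst_expr idfun (fun J u j =>
    if u is Phi then symb (s J) u j else - symb (s J) u j).

Definition Galois_op (iota : Qring p -> Qring p) : expr -> expr :=
  subst_expr iota symb.

(* [E J K k] is the coefficient of t^k in the expansion of the squared distance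
   between the lines J and K, for all perturbations satisfying [adm]. Without
   restriction on the perturbation, these expressions are unique. *)
Definition taylor_expansion (x : R) (theta : angle -> R)
    (adm : (letter -> angle -> nat -> R) -> (letter -> angle -> R -> R) -> Prop)
    (E : letter -> letter -> nat -> expr) : Prop :=
  forall (N : nat) (par : letter -> angle -> nat -> R)
         (rem : letter -> angle -> R -> R),
    (forall J u, rem J u =o_ (0 : R) (fun t : R => t ^+ N)) ->
    adm par rem ->
    forall J K : letter, J != K ->
      (fun t : R => sqdist x theta par rem N J K t
                    - \sum_(k < N.+1) eval_expr par (E J K k) * t ^+ k)
      =o_ (0 : R) (fun t : R => t ^+ N).

End Expressions.

(* In [{perm _}], [(s * t) J = t (s J)]. *)
Definition varpi : {perm letter} :=
  (tperm lA lB * tperm lA lC * (tperm lD lE * tperm lD lF))%g.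
Definition varrho : {perm letter} :=
  (tperm lA lD * tperm lB lF * tperm lC lE)%g.
Definition varsigma : {perm letter} := (tperm lB lC * tperm lD lF)%g.

Lemma varpiE :
  [seq varpi J | J <- [:: lA; lB; lC; lD; lE; lF]]
  = [:: lB; lC; lA; lE; lF; lD].
Proof. by rewrite /= /varpi !permM /tperm !permE. Qed.

Lemma varrhoE :
  [seq varrho J | J <- [:: lA; lB; lC; lD; lE; lF]]
  = [:: lD; lF; lE; lA; lC; lB].
Proof. by rewrite /= /varrho !permM /tperm !permE. Qed.

Lemma varsigmaE :
  [seq varsigma J | J <- [:: lA; lB; lC; lD; lE; lF]]
  = [:: lA; lC; lB; lF; lE; lD].
Proof. by rewrite /= /varsigma !permM /tperm !permE. Qed.

Definition letter_group : {group {perm letter}} :=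
  <<[set varpi; varrho; varsigma]%SET>>%G.

(* Composition closure of [gens] together with the inverses of its bijections:
   the generated group when [gens] consists of bijections. *)
Inductive generated (T : Type) (gens : set (T -> T)) : (T -> T) -> Prop :=
| gen_id : generated gens id
| gen_in f of gens f : generated gens f
| gen_comp f g of generated gens f & generated gens g : generated gens (f \o g)
| gen_inv f g of generated gens f & cancel f g & cancel g f : generated gens g.

Section Symmetry.
Context {R : realType} (p : R).
Local Notation expr := (expr p).

Definition Pi_varsigma (iota : Qring p -> Qring p) : expr -> expr :=
  Galois_op iota \o Pi_circ varsigma.

Definition preserves (E : letter -> letter -> nat -> expr)
    (op : expr -> expr) (s : {perm letter}) : Prop :=
  forall (J K : letter) (k : nat), J != K -> op (E J K k) = E (s J) (s K) k.

(* [psi] is a group isomorphism from [letter_group] onto the group generated by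
   the three operators, [s] being the underlying permutation of [psi s]; the
   order of the composition is explained by [(s * t) J = t (s J)]. *)
Definition operator_group_iso (iota : Qring p -> Qring p)
    (psi : {perm letter} -> expr -> expr) : Prop :=
  [/\ {in letter_group &, forall s t, psi (s * t)%g = psi t \o psi s},
      {in letter_group &, injective psi},
      forall f : expr -> expr,
        generated [set Pi_perm varpi; Pi_perm varrho; Pi_varsigma iota] f
        <-> exists2 s, s \in letter_group & f = psi s
    & {in letter_group, forall s J u j,
        psi s (symb p J u j) = symb p (s J) u j
        \/ psi s (symb p J u j) = - symb p (s J) u j}].

Definition restores_D6 (iota : Qring p -> Qring p)
    (E : letter -> letter -> nat -> expr) : Prop :=
  [/\ [/\ preserves E (Pi_perm varpi) varpi, preserves E (Pi_perm varrho) varrho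
        & preserves E (Pi_varsigma iota) varsigma],
      exists psi, operator_group_iso iota psi,
      letter_group \isog 'D_12
    & forall s : {perm letter}, s \in letter_group <-> @C6_symmetry R s].

End Symmetry.

(* Main.v *)
(* For two non-parallel lines with unit directions u, v and points P, Q the
   squared distance is det(P - Q, u, v)^2 / |u x v|^2. For tangent lines both
   terms are polynomials in the sines and cosines of the angles. With the
   normalization constants [theta] each of these is, up to constant factors that
   cancel in the quotient, a power series over the field Q[p] in the perturbation
   of the angle, because sin^2 phi, tan^2 delta, cos^2 kappa and p tan kappa /
   sqrt 3, p sin phi tan delta / sqrt 3 are rational. The quotient is a power
   series as well: the denominator does not vanish at the base configuration.
   For the pairs AD, BE, CF, AF, BD, CE this uses the irrationality of p.

   The conjugation p |-> -p changes the signs of kappa and delta, which is the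
   effect of a reflection of the sphere in a plane through the axis; the
   reflection also induces the permutation varsigma of the lines. *)
Require Import Defs.
From HB Require Import structures.
From mathcomp Require Import all_boot all_order all_algebra all_fingroup.
From mathcomp Require Import all_solvable finmap monalg.
From mathcomp Require Import boolp classical_sets reals topology normedtype.
From mathcomp Require Import landau trigo.
From mathcomp Require derive.
From mathcomp Require Import zify ring lra.

Set Implicit Arguments.
Unset Strict Implicit.
Unset Printing Implicit Defensive.

Import Order.TTheory GRing.Theory Num.Theory numFieldNormedType.Exports.
Local Open Scope ring_scope.

(** * Ring morphisms out of the expressions *)

(** The series of the squared distance is written once, for an arbitrary commutative ring [S] and a
    map [c] from Q[p] to [S]. With real coefficients it expands the distance functions; with
    coefficients in the ring of expressions it yields the Taylor coefficients. Evaluation and the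
    operators are ring morphisms, so they only change [c] and the values of the symbols. Each
    symmetry thus becomes an identity between data of the base configuration: the hemisphere signs
    of two lines and the cosine and sine of the difference of their longitudes. The ring of
    expressions is not a field. Hence only the constant term of the denominator is inverted, inside
    Q[p] and before [c] is applied; a geometric sum does the rest. A constant theta need not lie in
    Q[p]: the series of cos(theta s) and sin(theta s) / theta contain only theta^2. The symbols of
    [A] are kept while the symmetries are proved, since [varpi] and [varrho] move [A]; they are
    erased afterwards. *)

Section MonomAt.
Variables (S : comNzRingType) (h : symbol -> S).

Lemma monom_atEw (d : {fset symbol}) (m : {cmonom symbol}) :
  (finsupp m `<=` d)%fset -> monom_at h m = \prod_(s <- d) h s ^+ m s.
Proof.
move=> le_md; rewrite /monom_at (big_fset_incl _ le_md) // => s _ s_m.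
by rewrite (eqP (_ : m s == 0%N)) ?expr0 // cmE_eq0.
Qed.

Lemma monom_at_mmorphism : mmorphism (monom_at h).
Proof.
split=> [m1 m2|]; last by rewrite /monom_at mdom1 big_seq_fset0.
pose d := (finsupp m1 `|` finsupp m2)%fset.
rewrite (@monom_atEw d) ?mdomD // (@monom_atEw d) ?fsubsetUl //.
rewrite (@monom_atEw d m2) ?fsubsetUr // -big_split /=.
by apply: eq_bigr => s _; rewrite cmM exprD.
Qed.

HB.instance Definition _ := isMultiplicative.Build _ _ (monom_at h) monom_at_mmorphism.

End MonomAt.

Section ExprMorphisms.
Variables (R : realType) (p : R).
Local Notation expr := (expr p).

Lemma eval_expr_zmod_morphism par : zmod_morphism (@eval_expr R p par).
Proof. exact: (raddfB (mmap _ _)). Qed.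

Lemma eval_expr_monoid_morphism par : monoid_morphism (@eval_expr R p par).
Proof. by split; [exact: (rmorph1 (mmap _ _))|exact: (rmorphM (mmap _ _))]. Qed.

HB.instance Definition _ par := GRing.isZmodMorphism.Build _ _
  (@eval_expr R p par) (eval_expr_zmod_morphism par).
HB.instance Definition _ par := GRing.isMonoidMorphism.Build _ _
  (@eval_expr R p par) (eval_expr_monoid_morphism par).

Variable iota : {rmorphism Qring p -> Qring p}.
Implicit Type h : letter -> angle -> nat -> expr.

Let malgC_rmorphism : {rmorphism Qring p -> expr} := @malgC _ _.

Lemma subst_expr_zmod_morphism h : zmod_morphism (subst_expr iota h).
Proof. exact: (raddfB (mmap (malgC_rmorphism \o iota) _)). Qed.

Lemma subst_expr_monoid_morphism h : monoid_morphism (subst_expr iota h).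
Proof.
by split; [exact: (rmorph1 (mmap (malgC_rmorphism \o iota) _))|
  exact: (rmorphM (mmap (malgC_rmorphism \o iota) _))].
Qed.

HB.instance Definition _ h := GRing.isZmodMorphism.Build _ _
  (subst_expr iota h) (subst_expr_zmod_morphism h).
HB.instance Definition _ h := GRing.isMonoidMorphism.Build _ _
  (subst_expr iota h) (subst_expr_monoid_morphism h).

End ExprMorphisms.

Lemma monom_at_ucm (S : comNzRingType) (h : symbol -> S) s :
  monom_at h (ucm s) = h s.
Proof. by rewrite /monom_at mdomU big_seq_fset1 cmUU expr1. Qed.

Lemma mmap_symb (S : comNzRingType) (A : comNzRingType) (f : {rmorphism A -> S}) (h : symbol -> S) s :
  mmap f (monom_at h) << ucm s >> = h s.
Proof. by rewrite mmapU /= rmorph1 mul1r monom_at_ucm. Qed.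

Section ExprTheory.
Variables (R : realType) (p : R).
Local Notation expr := (expr p).

Lemma eval_expr_symb par J u j : eval_expr par (symb p J u j) = par J u j.
Proof. by rewrite /eval_expr mmap_symb. Qed.

Lemma eval_exprC par (c : Qring p) : eval_expr par (c%:MP : expr) = val c.
Proof. exact: (@mmapC _ _ _ val). Qed.

Let malgC_rmorphism : {rmorphism Qring p -> expr} := @malgC _ _.

Lemma subst_expr_symb (iota : {rmorphism Qring p -> Qring p}) h J u j :
  subst_expr iota h (symb p J u j) = h J u j.
Proof. exact: (@mmap_symb _ _ (malgC_rmorphism \o iota)). Qed.

Lemma subst_exprC (iota : {rmorphism Qring p -> Qring p}) h (c : Qring p) :
  subst_expr iota h (c%:MP : expr) = (iota c)%:MP.
Proof. exact: (@mmapC _ _ _ (malgC_rmorphism \o iota)). Qed.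

(** Monomials are exponent functions; the partial products carry their exponents along, so that both
    sides can be compared exponent by exponent. *)
Lemma malgU_prod (m : {cmonom symbol}) :
  << m >> = \prod_(s <- finsupp m) << ucm s >> ^+ m s :> expr.
Proof.
have mulU (m1 m2 : {cmonom symbol}) :
    << mmul m1 m2 >> = << m1 >> * << m2 >> :> expr.
  by rewrite malgM_def fgmulUU mulr1.
have expU s n : exists2 u : {cmonom symbol}, << ucm s >> ^+ n = << u >> :> expr
    & forall i, u i = ((s == i) * n)%N.
  elim: n => [|n [u IHu uE]].
    by exists (mone : {cmonom symbol}) => [|i]; rewrite ?expr0 // cm1 muln0.
  exists (mmul (ucm s) u) => [|i]; first by rewrite exprS IHu mulU.
  by rewrite cmM uE cmU mulnS.
have prodU (r : seq symbol) : uniq r -> exists2 u : {cmonom symbol},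
    \prod_(s <- r) << ucm s >> ^+ m s = << u >> :> expr
    & forall i, u i = ((i \in r) * m i)%N.
  elim: r => [|s r IHr] /=; first by exists (mone : {cmonom symbol}) => [|i]; rewrite ?big_nil ?cm1.
  case/andP=> s_r /IHr[u IHu uE]; have [v Ev vE] := expU s (m s).
  exists (mmul v u) => [|i]; first by rewrite big_cons IHu Ev mulU.
  rewrite cmM uE vE inE eq_sym; case: eqP => [->|_] //=.
  by rewrite (negPf s_r) mul0n addn0.
have [u -> uE] := prodU _ (fset_uniq (finsupp m)).
congr (<< _ >>); apply/eqP/cmP => i; rewrite uE.
by case: mdomP => //=; rewrite mul1n.
Qed.

(** Uniqueness in the universal property of polynomial rings; identities between operators are
    checked on constants and symbols through it. *)
Lemma expr_rmorphism_ext (S : comNzRingType) (f g : {rmorphism expr -> S}) :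
  (forall c : Qring p, f c%:MP = g c%:MP) ->
  (forall J u j, f (symb p J u j) = g (symb p J u j)) -> f =1 g.
Proof.
move=> fgC fgU e; rewrite (monalgE e) !rmorph_sum; apply: eq_bigr => m _.
have -> : << e@_m *g m >> = (e@_m)%:MP * << m >> :> expr.
  by rewrite malgM_def fgmulUU mulr1 mul1m.
rewrite malgU_prod !rmorphM fgC !rmorph_prod; congr (_ * _).
by apply: eq_bigr => -[[J u] j] _; rewrite !rmorphXn /= fgU.
Qed.

Lemma subst_expr_id (iota : {rmorphism Qring p -> Qring p}) h :
  iota =1 id -> (forall J u j, h J u j = symb p J u j) -> subst_expr iota h =1 id.
Proof.
move=> iota1 h1; apply: (@expr_rmorphism_ext _ (subst_expr iota h) idfun).
  by move=> c; rewrite /= subst_exprC iota1.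
by move=> J u j; rewrite /= subst_expr_symb h1.
Qed.

Lemma subst_expr_comp (iota1 iota2 iota3 : {rmorphism Qring p -> Qring p}) h1 h2 h3 :
  iota1 \o iota2 =1 iota3 ->
  (forall J u j, subst_expr iota1 h1 (h2 J u j) = h3 J u j) ->
  subst_expr iota1 h1 \o subst_expr iota2 h2 =1 subst_expr iota3 h3.
Proof.
move=> iotaE hE.
apply: (@expr_rmorphism_ext _ (subst_expr iota1 h1 \o subst_expr iota2 h2)
          (subst_expr iota3 h3)).
  by move=> c; rewrite /= !subst_exprC -iotaE.
by move=> J u j; rewrite /= !subst_expr_symb hE.
Qed.

End ExprTheory.

(** * The quadratic ring Q[p] *)

Section QuadraticRing.
Variables (R : realType) (p : R).

Lemma ratr_Qadjoin (r : rat) : ratr r \in Qadjoin p.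
Proof. by apply/asboolP; exists r%:P; rewrite map_polyC hornerC. Qed.

Definition qc (r : rat) : Qring p := QRing (ratr_Qadjoin r).

Lemma qc_zmod_morphism : zmod_morphism qc.
Proof. by move=> a b; apply: val_inj; rewrite /= !rmorphB. Qed.

Lemma qc_monoid_morphism : monoid_morphism qc.
Proof. by split=> [|a b]; apply: val_inj; rewrite /= ?rmorph1 ?rmorphM. Qed.

HB.instance Definition _ := GRing.isZmodMorphism.Build _ _ qc qc_zmod_morphism.
HB.instance Definition _ :=
  GRing.isMonoidMorphism.Build _ _ qc qc_monoid_morphism.

Definition qelt (a b : rat) : Qring p := qc a + qc b * Qgen p.

Lemma val_qelt a b : val (qelt a b) = ratr a + ratr b * p.
Proof. by rewrite /qelt rmorphD rmorphM. Qed.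

Variable d : rat.
Hypothesis px2 : p ^+ 2 = ratr d.
Hypothesis p_irr : ~ exists q : rat, p = ratr q.

(** Since [p ^+ 2] is [d], multiplication by [p] sends the coordinates [(a, b)] to [(b * d, a)], so
    degrees never exceed one. *)
Lemma qelt_surj c : exists ab, c = qelt ab.1 ab.2.
Proof.
case: c => r rP; have /asboolP[f rE] := rP.
suff [a [b E]] : exists a b : rat, r = ratr a + ratr b * p.
  by exists (a, b); apply: val_inj; rewrite val_qelt.
rewrite rE; elim/poly_ind: f {rE} => [|f c [a [b IHf]]].
  by exists 0, 0; rewrite rmorph0 horner0 rmorph0 mul0r addr0.
exists (b * d + c), a.
rewrite rmorphD rmorphM /= map_polyX map_polyC hornerD hornerC hornerMX IHf.
by rewrite rmorphD rmorphM /= -px2; ring.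
Qed.

Lemma qelt_eq0 a b : qelt a b = 0 -> a = 0 /\ b = 0.
Proof.
move=> /(congr1 val); rewrite val_qelt /= => ab0.
have b0 : b = 0.
  apply/eqP/negPn/negP => b0; apply: p_irr; exists (- (a / b)).
  have rb0 : ratr b != 0 :> R by rewrite fmorph_eq0.
  rewrite rmorphN fmorph_div /=; apply: (mulfI rb0).
  by rewrite mulrN mulrCA divff // mulr1; apply: (addrI (ratr a)); rewrite ab0 subrr.
split=> //; apply/eqP; move/eqP: ab0.
by rewrite b0 rmorph0 mul0r addr0 fmorph_eq0.
Qed.

Lemma qelt_inj a b a' b' : qelt a b = qelt a' b' -> a = a' /\ b = b'.
Proof.
move=> E; have /qelt_eq0[] : qelt (a - a') (b - b') = 0.
  have -> : qelt (a - a') (b - b') = qelt a b - qelt a' b'.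
    by rewrite /qelt !rmorphB /=; ring.
  by rewrite E subrr.
by move=> /eqP + /eqP; rewrite !subr_eq0 => /eqP-> /eqP->.
Qed.

(** Irrationality of [p] makes the coordinates unique, so changing the sign of the second one is
    well defined; it is multiplicative because the sign cancels in [p ^+ 2]. *)
Lemma Galois_exists : exists2 iota : {rmorphism Qring p -> Qring p},
  iota (Qgen p) = - Qgen p & forall r, iota (qc r) = qc r.
Proof.
pose f c := let ab := projT1 (cid (qelt_surj c)) in qelt ab.1 (- ab.2).
have fE a b : f (qelt a b) = qelt a (- b).
  by rewrite /f; case: cid => -[a' b'] /= /qelt_inj[-> ->].
have fB : zmod_morphism f.
  move=> u v; have [[a b] ->] := qelt_surj u; have [[a' b'] ->] := qelt_surj v.
  rewrite /= !fE (_ : qelt a b - _ = qelt (a - a') (b - b')) ?fE /qelt.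
    by rewrite !rmorphN !rmorphB /=; ring.
  by rewrite !rmorphB /=; ring.
have gen2 : Qgen p * Qgen p = qc d by apply: val_inj; rewrite /= -px2 expr2.
have fM : monoid_morphism f.
  split.
    by rewrite (_ : 1 = qelt 1 0) ?fE /qelt ?oppr0 rmorph1 rmorph0 mul0r addr0.
  move=> u v; have [[a b] ->] := qelt_surj u; have [[a' b'] ->] := qelt_surj v.
  rewrite /= !fE (_ : qelt a b * _ = qelt (a * a' + b * b' * d) (a * b' + b * a')).
    by rewrite fE /qelt !rmorphN !rmorphD !rmorphM /= -gen2; ring.
  by rewrite /qelt !rmorphD !rmorphM /= -gen2; ring.
pose fm : {rmorphism Qring p -> Qring p} := HB.pack f
  (GRing.isZmodMorphism.Build _ _ f fB) (GRing.isMonoidMorphism.Build _ _ f fM).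
exists fm => [|r]; rewrite /fm /=.
  have genE : qelt 0 1 = Qgen p by rewrite /qelt rmorph0 rmorph1 mul1r add0r.
  by rewrite -{1}genE fE /qelt rmorphN rmorph0 rmorph1 mulN1r add0r.
rewrite (_ : qc r = qelt r 0) ?fE /qelt ?oppr0 // rmorph0 mul0r addr0 //.
Qed.

Lemma Galois_involutive (iota : {rmorphism Qring p -> Qring p}) :
  iota (Qgen p) = - Qgen p -> (forall r, iota (qc r) = qc r) -> involutive iota.
Proof.
move=> iotap iotaq c; have [[a b] ->] := qelt_surj c.
by rewrite /qelt !(rmorphD, rmorphM, iotaq, iotap) !rmorphN /= iotap opprK.
Qed.

(** Multiplication by the conjugate [a - b p] turns the denominator into the rational norm
    [a ^+ 2 - b ^+ 2 * d]. *)
Lemma Qadjoin_inv r : r \in Qadjoin p -> r^-1 \in Qadjoin p.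
Proof.
move=> rP; have [[a b] /(congr1 val)] := qelt_surj (QRing rP).
rewrite val_qelt /= => rE.
have [->|r0] := eqVneq r 0; first by rewrite invr0 rpred0.
have [s0|s0] := eqVneq (ratr a - ratr b * p) 0.
  have : qelt a (- b) = 0 by apply: val_inj; rewrite val_qelt rmorphN mulNr.
  by case/qelt_eq0 => a0 /eqP; rewrite oppr_eq0 => /eqP b0;
    rewrite rE a0 b0 rmorph0 mul0r addr0 eqxx in r0.
have -> : r^-1 = val (qelt a (- b)) * ratr (a ^+ 2 - b ^+ 2 * d)^-1.
  rewrite val_qelt fmorphV rmorphB (rmorphM _ (b ^+ 2)) !rmorphXn rmorphN /= -px2.
  have -> : ratr a ^+ 2 - ratr b ^+ 2 * p ^+ 2
            = r * (ratr a + - ratr b * p) :> R by rewrite rE; ring.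
  by rewrite invfM mulrCA mulNr divff // mulr1.
by rewrite rpredM ?ratr_Qadjoin // (valP (qelt _ _)).
Qed.

(** Under the hypotheses on [p] the default [0] is never taken, by [Qadjoin_inv]. *)
Definition qinv (c : Qring p) : Qring p := insubd (0 : Qring p) (val c)^-1.

Lemma val_qinv c : val (qinv c) = (val c)^-1.
Proof. by rewrite /qinv insubdK ?Qadjoin_inv //; case: c. Qed.

Lemma qinvV (c : Qring p) : c != 0 -> c * qinv c = 1.
Proof.
move=> c0; apply: val_inj; rewrite rmorphM /= val_qinv divff //.
Qed.

Lemma rmorph_qinv (iota : {rmorphism Qring p -> Qring p}) c :
  c != 0 -> iota (qinv c) = qinv (iota c).
Proof.
move=> /qinvV/(congr1 iota); rewrite rmorphM rmorph1 => E; apply: val_inj.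
rewrite val_qinv; have valE : val (iota c) * val (iota (qinv c)) = 1 := congr1 val E.
have c0 : val (iota c) != 0.
  by apply: contraPneq (oner_neq0 R) => c0; rewrite -valE c0 mul0r eqxx.
by apply: (mulfI c0); rewrite valE divff.
Qed.

End QuadraticRing.

(** * Distance between skew lines *)

Section SkewLines.
Variable R : realType.
Implicit Types P Q u v : 'rV[R]_3.

Definition dot3 u v : R := \sum_(j < 3) u 0 j * v 0 j.

Definition cross3 u v : 'rV[R]_3 :=
  vec3 (u 0 1 * v 0 2%:R - u 0 2%:R * v 0 1) (u 0 2%:R * v 0 0 - u 0 0 * v 0 2%:R)
       (u 0 0 * v 0 1 - u 0 1 * v 0 0).

Lemma dot3E u v : dot3 u v = u 0 0 * v 0 0 + u 0 1 * v 0 1 + u 0 2%:R * v 0 2%:R.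
Proof.
rewrite /dot3 !big_ord_recl big_ord0 addr0 addrA.
by congr (_ * _ + _ * _ + _ * _); congr (_ 0 _); apply: val_inj.
Qed.

Lemma vec3E (a b c : R) :
  (vec3 a b c 0 0 = a) * (vec3 a b c 0 1 = b) * (vec3 a b c 0 2%:R = c).
Proof. by rewrite /vec3 !mxE. Qed.

Lemma eq_vec3 u v : u 0 0 = v 0 0 -> u 0 1 = v 0 1 -> u 0 2%:R = v 0 2%:R -> u = v.
Proof.
move=> e0 e1 e2; apply/rowP => -[[|[|[|//]]] lt_j3].
- by rewrite (_ : Ordinal _ = 0) //; apply: val_inj.
- by rewrite (_ : Ordinal _ = 1) //; apply: val_inj.
- by rewrite (_ : Ordinal _ = 2%:R) //; apply: val_inj.
Qed.

Definition line P u : set 'rV[R]_3 := [set P + s *: u | s in setT]%classic.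

(** Cramer's rule in the basis [u], [v], [m], cleared of the denominator [dot3 m m]. *)
Lemma cross3_decomposition u v w (m := cross3 u v) :
  dot3 m m *: w
  = dot3 (cross3 w v) m *: u + dot3 (cross3 u w) m *: v + dot3 w m *: m.
Proof.
by apply: eq_vec3; rewrite !dot3E /m /cross3 !vec3E !mxE /=; ring.
Qed.

(** All vectors joining the two lines have the same component along the common normal [m], which
    bounds their length from below; the feet of the common perpendicular attain the bound. *)
Lemma line_dist_skew P u Q v (m := cross3 u v) : dot3 m m != 0 ->
  line_dist (line P u) (line Q v) ^+ 2 = dot3 (P - Q) m ^+ 2 / dot3 m m.
Proof.
move=> m0; have m_gt0 : 0 < dot3 m m.
  by rewrite lt_def m0 sumr_ge0 // => j _; rewrite -expr2 sqr_ge0.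
set D := dot3 (P - Q) m; pose r := `|D| / Num.sqrt (dot3 m m).
have r2 : r ^+ 2 = D ^+ 2 / dot3 m m.
  by rewrite /r exprMn exprVn sqr_sqrtr ?ltW // real_normK ?num_real.
suff -> : line_dist (line P u) (line Q v) = r by [].
have norm2 w : eucl_norm w ^+ 2 = dot3 w w.
  rewrite /eucl_norm sqr_sqrtr; first by apply: eq_bigr => j _; rewrite expr2.
  by apply: sumr_ge0 => j _; rewrite sqr_ge0.
have norm_ge0 w : 0 <= eucl_norm w by rewrite sqrtr_ge0.
have r_ge0 : 0 <= r by rewrite divr_ge0 ?sqrtr_ge0.
have lb : lbound [set eucl_norm (w - z) | w in line P u & z in line Q v]%classic r.
  move=> _ [_ [s _ <-]] [_ [t _ <-]] <-.
  rewrite -(ler_pXn2r (n := 2)) ?nnegrE ?norm_ge0 // r2 norm2 ler_pdivrMr //.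
  set w := _ - _; have -> : D = dot3 w m.
    by rewrite /D /w /m !dot3E !vec3E !mxE; ring.
  (* Lagrange's identity: |w|^2 |m|^2 - (w . m)^2 = |w x m|^2. *)
  rewrite -subr_ge0 (_ : _ - _ = dot3 (cross3 w m) (cross3 w m)).
    by apply: sumr_ge0 => j _; rewrite -expr2 sqr_ge0.
  by rewrite !dot3E !vec3E; ring.
apply/eqP; rewrite eq_le; apply/andP; split; last first.
  apply: lb_le_inf => //; exists (eucl_norm (P - Q)).
  exists P; first by exists 0 => //; rewrite scale0r addr0.
  by exists Q => //; exists 0 => //; rewrite scale0r addr0.
apply: ge_inf; first by exists r.
(* [X] is orthogonal to [m], hence a combination of [u] and [v]; its coordinates move [P] and [Q] to
   the feet of the common perpendicular. *)
pose X := (D / dot3 m m) *: m - (P - Q).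
exists (P + (dot3 (cross3 X v) m / dot3 m m) *: u); first by eexists.
exists (Q + (- (dot3 (cross3 u X) m / dot3 m m)) *: v); first by eexists.
set w := _ - _; have -> : w = (D / dot3 m m) *: m.
  have Xm : dot3 X m = 0.
    have dotB k w1 w2 : dot3 (k *: w1 - w2) w1 = k * dot3 w1 w1 - dot3 w2 w1.
      by rewrite !dot3E !mxE; ring.
    by rewrite /X dotB divfK ?subrr.
  have XE : dot3 m m *: X = dot3 (cross3 X v) m *: u + dot3 (cross3 u X) m *: v.
    by rewrite (cross3_decomposition u v) Xm scale0r addr0.
  rewrite -[RHS](subrK (P - Q)) -/X -[X](scalerK m0) XE /w scalerDr !scalerA.
  by rewrite ![_^-1 * _]mulrC scaleNr opprD opprK addrACA addrC.
apply/eqP; rewrite -(eqrXn2 (n := 2)) ?norm_ge0 // r2 norm2.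
have dotZ k z : dot3 (k *: z) (k *: z) = k ^+ 2 * dot3 z z.
  by rewrite !dot3E !mxE; ring.
by rewrite dotZ; apply/eqP; field.
Qed.

End SkewLines.

(* For two lines with latitudes [phi_i], longitudes [lam_i] and directions
   [del_i], with [C = cos del], [S = sin del], [F = sin phi], [K = cos phi],
   [G = cos (lam_1 - lam_2)], [L = sin (lam_1 - lam_2)] and all weights equal to
   [1], [skew_uv] is the inner product of the unit directions and [skew_det] the
   determinant formed by them and the vector joining the points of tangency. *)
Section Skew.
Variable A : comNzRingType.

Record weights := Weights { w_f2 : A; w_c2 : A; w_T2 : A; w_rho : A; w_eta : A }.

Variables (w : weights) (C1 S1 F1 K1 C2 S2 F2 K2 G L : A).

Definition skew_X := w_f2 w * F1 * F2 * G + w_c2 w * K1 * K2.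
Definition skew_uv := C1 * C2 * skew_X
  + w_rho w * (C1 * S2 * F1 - S1 * C2 * F2) * L + w_T2 w * S1 * S2 * G.
Definition skew_det := (w_eta w * C1 * C2 - w_rho w * S1 * S2) * (F1 - F2) * L
  + (C1 * S2 + C2 * S1) * (G - skew_X).
Definition skew_den := (C1 ^+ 2 + w_T2 w * S1 ^+ 2)
  * (C2 ^+ 2 + w_T2 w * S2 ^+ 2) - skew_uv ^+ 2.
End Skew.

(** * Distance between two tangent lines *)

Section TangentLines.
Variable R : realType.
Implicit Types phi lam del : R.

Let one_weights : weights R := Weights 1 1 1 1 1.

Lemma tangent_line_dist phi1 lam1 del1 phi2 lam2 del2
    (fn := fun sk : weights R -> R -> R -> R -> R -> R -> R -> R -> R -> R -> R -> R =>
       sk one_weights (cos del1) (sin del1) (sin phi1) (cos phi1)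
          (cos del2) (sin del2) (sin phi2) (cos phi2)
          (cos (lam1 - lam2)) (sin (lam1 - lam2))) :
  fn (@skew_den R) != 0 ->
  line_dist (tangent_line phi1 lam1 del1) (tangent_line phi2 lam2 del2) ^+ 2
  = fn (@skew_det R) ^+ 2 / fn (@skew_den R).
Proof.
move=> den0.
pose u phi lam del := cos del *: north phi lam + sin del *: west lam.
set m := cross3 (u phi1 lam1 del1) (u phi2 lam2 del2).
have denE : dot3 m m = fn (@skew_den R).
  rewrite /m /fn /cross3 /u dot3E. rewrite !vec3E !mxE /skew_den /skew_uv /skew_X /= cosB sinB.
  ring: (cos2sin2 phi1) (cos2sin2 phi2) (cos2sin2 lam1) (cos2sin2 lam2).
rewrite (line_dist_skew (sphere_point phi1 lam1) (sphere_point phi2 lam2)) denE //.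
congr (_ ^+ 2 / _).
rewrite /m /fn /cross3 /u dot3E !vec3E !mxE /skew_det /skew_X /= cosB sinB.
ring: (cos2sin2 phi1) (cos2sin2 phi2) (cos2sin2 lam1) (cos2sin2 lam2).
Qed.

(** Here [f], [c], [T], [g], [r] stand for sin phi, cos phi, tan delta, cos delta and sqrt 3. Only
    the combinations f^2, c^2, T^2, rTf and rf/T survive when they are pulled out, and these lie in
    Q[p] even when the factors do not. The weights store them. *)
Lemma skew_scale (w : weights R) (f c T g r C1 S1 F1 K1 C2 S2 F2 K2 G L : R)
    (fn := fun sk : weights R -> R -> R -> R -> R -> R -> R -> R -> R -> R -> R -> R =>
       sk one_weights (g * C1) (g * (T * S1)) (f * F1) (c * K1)
          (g * C2) (g * (T * S2)) (f * F2) (c * K2) G (r * L)) :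
  w_f2 w = f ^+ 2 -> w_c2 w = c ^+ 2 -> w_T2 w = T ^+ 2 ->
  w_rho w = r * T * f -> T * w_eta w = r * f ->
  fn (@skew_den R) = g ^+ 4 * skew_den w C1 S1 F1 K1 C2 S2 F2 K2 G L
  /\ fn (@skew_det R) = g ^+ 2 * T * skew_det w C1 S1 F1 K1 C2 S2 F2 K2 G L.
Proof.
rewrite /fn /skew_den /skew_det /skew_uv /skew_X /= => -> -> -> -> etaE.
by split; ring: etaE.
Qed.

End TangentLines.

(** * Taylor polynomials of sine and cosine *)

Section TrigoTaylor.
Local Open Scope classical_set_scope.
Local Open Scope ring_scope.
Import derive.
Variable R : realType.

Lemma MVT_norm_exp (f df : R -> R) k : (forall x : R, is_derive x 1 f (df x)) ->
  f 0 = 0 -> (forall x, `|df x| <= `|x| ^+ k) -> forall x, `|f x| <= `|x| ^+ k.+1.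
Proof.
move=> f_df f0 df_le x.
have f_cont (a b : R) : {within `[a, b], continuous f}.
  apply: continuous_subspaceT => y.
  apply/differentiable_continuous/derivable1_diffP.
  by apply: ex_derive; exact: f_df.
have [c c_le fxE] : exists2 c, `|c| <= `|x| & f x = df c * x.
  have [x_ge0|x_lt0] := lerP 0 x.
    have [c /itvP c_in] := MVT_segment x_ge0 (fun y _ => f_df y) (f_cont _ _).
    by rewrite f0 !subr0 => fx; exists c; rewrite ?ger0_norm ?c_in.
  have [c /itvP c_in] := MVT_segment (ltW x_lt0) (fun y _ => f_df y) (f_cont _ _).
  rewrite f0 !sub0r mulrN => /oppr_inj fx; exists c => //.
  by rewrite !ler0_norm ?lerN2 ?c_in // ltW.
rewrite fxE normrM exprSr ler_wpM2r // (le_trans (df_le c)) //.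
by rewrite lerXn2r ?nnegrE.
Qed.

Definition cos_coef i : rat := (-1) ^+ i / (i.*2)`!%:R.
Definition sin_coef i : rat := (-1) ^+ i / (i.*2.+1)`!%:R.

Definition cos_poly n : {poly R} := \sum_(i < n) ratr (cos_coef i) *: 'X^(i.*2).
Definition sin_poly n : {poly R} := \sum_(i < n) ratr (sin_coef i) *: 'X^(i.*2.+1).

Lemma deriv_sin_poly n : (sin_poly n)^`() = cos_poly n.
Proof.
rewrite /sin_poly raddf_sum; apply: eq_bigr => i _ /=.
rewrite derivZ derivXn -scaler_nat scalerA; congr (_ *: _).
rewrite -(ratr_nat R) -rmorphM /=; congr ratr.
rewrite /sin_coef factS natrM -mulrA; congr (_ * _).
by rewrite invfM mulrAC mulVf ?mul1r ?pnatr_eq0.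
Qed.

Lemma deriv_cos_poly n : (cos_poly n.+1)^`() = - sin_poly n.
Proof.
rewrite /cos_poly big_ord_recl raddfD /= derivZ derivXn mulr0n scaler0 add0r.
rewrite raddf_sum -sumrN; apply: eq_bigr => i _ /=.
rewrite derivZ derivXn -scaler_nat scalerA -scaleNr; congr (_ *: _).
rewrite -(ratr_nat R) -rmorphM -rmorphN /=; congr ratr.
rewrite /cos_coef /sin_coef /bump /= add1n doubleS exprS factS natrM mulN1r !mulNr.
by rewrite -mulrA invfM mulrAC mulVf ?mul1r ?pnatr_eq0.
Qed.

(** Simultaneous induction: the error of sine has as derivative the error of cosine with the same
    number of terms, and the error of cosine minus that of sine with one term fewer. *)
Lemma trig_poly_bound n x :
  `|cos x - (cos_poly n).[x]| <= `|x| ^+ n.*2 /\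
  `|sin x - (sin_poly n).[x]| <= `|x| ^+ n.*2.+1.
Proof.
have dsin m (y : R) : is_derive y 1 (fun x => sin x - (sin_poly m).[x])
    (cos y - (cos_poly m).[y]).
  by rewrite -deriv_sin_poly; apply: is_deriveB.
have dcos m (y : R) : is_derive y 1 (fun x => cos x - (cos_poly m.+1).[x])
    (- (sin y - (sin_poly m).[y])).
  rewrite opprB addrC -[X in _ + X]opprK -hornerN -deriv_cos_poly; apply: is_deriveB.
elim: n x => [|n IHn] x.
  split; first by rewrite /cos_poly big_ord0 horner0 subr0 cos_max.
  apply: (MVT_norm_exp (dsin 0)) x => [|y].
    by rewrite sin0 /sin_poly big_ord0 horner0 subr0.
  by rewrite /cos_poly big_ord0 horner0 subr0 cos_max.
have cosn y : `|cos y - (cos_poly n.+1).[y]| <= `|y| ^+ n.+1.*2.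
  apply: (MVT_norm_exp (dcos n)) y => [|y]; last by rewrite normrN; case: (IHn y).
  rewrite cos0 /cos_poly big_ord_recl hornerD horner_sum big1 ?addr0.
    by rewrite hornerZ hornerXn expr0 mulr1 /cos_coef fact0 expr0 divr1 rmorph1 subrr.
  by move=> i _; rewrite hornerZ hornerXn expr0n mulr0.
split=> //; apply: (MVT_norm_exp (dsin n.+1)) x => //.
rewrite sin0 /sin_poly horner_sum big1 ?subr0 // => i _.
by rewrite hornerZ hornerXn expr0n mulr0.
Qed.

Lemma norm_sin_le (x : R) : `|sin x| <= `|x|.
Proof.
by have [_] := trig_poly_bound 0 x; rewrite /sin_poly big_ord0 horner0 subr0.
Qed.

Let half_sumB (x y : R) : x = (x + y) / 2 + (x - y) / 2 /\
  y = (x + y) / 2 - (x - y) / 2.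
Proof. by split; field. Qed.

Let twice_sin_le (c x y : R) : `|c| <= 1 -> `|2 * (c * sin ((x - y) / 2))| <= `|x - y|.
Proof.
move=> c_le1; rewrite !normrM ger0_norm // mulrC -ler_pdivlMr //.
rewrite (le_trans (ler_piMl _ c_le1)) // (le_trans (norm_sin_le _)) //.
by rewrite normrM normfV (@ger0_norm _ 2).
Qed.

(** Serves to discard the o-term inside the argument of a sine. *)
Lemma sin_lipschitz (x y : R) : `|sin x - sin y| <= `|x - y|.
Proof.
have [Ex Ey] := half_sumB x y.
have -> : sin x - sin y = 2 * (cos ((x + y) / 2) * sin ((x - y) / 2)); last first.
  by rewrite twice_sin_le ?cos_max.
by rewrite [X in X - _](congr1 sin Ex) [X in _ - X](congr1 sin Ey) sinD sinB; ring.
Qed.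

Lemma cos_lipschitz (x y : R) : `|cos x - cos y| <= `|x - y|.
Proof.
have [Ex Ey] := half_sumB x y.
have -> : cos x - cos y = 2 * (- sin ((x + y) / 2) * sin ((x - y) / 2)); last first.
  by rewrite twice_sin_le // normrN sin_max.
by rewrite [X in X - _](congr1 cos Ex) [X in _ - X](congr1 cos Ey) cosD cosB; ring.
Qed.

End TrigoTaylor.

(** * Truncated power series and asymptotic expansions *)

Section TruncatedSeries.
Variable S : comNzRingType.
Implicit Types (P Q s : {poly S}) (a : nat -> S) (e : nat -> nat).

(** Congruence modulo X^(k+1): the coefficient of index [k] is included. *)
Definition eqmodX k P Q := forall i, (i <= k)%N -> P`_i = Q`_i.

Lemma eqmodXD k P P' Q Q' : eqmodX k P P' -> eqmodX k Q Q' ->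
  eqmodX k (P + Q) (P' + Q').
Proof. by move=> PP' QQ' i ik; rewrite !coefD PP' ?QQ'. Qed.

Lemma eqmodXN k P P' : eqmodX k P P' -> eqmodX k (- P) (- P').
Proof. by move=> PP' i ik; rewrite !coefN PP'. Qed.

Lemma eqmodXM k P P' Q Q' : eqmodX k P P' -> eqmodX k Q Q' ->
  eqmodX k (P * Q) (P' * Q').
Proof.
move=> PP' QQ' i ik; rewrite !coefM; apply: eq_bigr => -[j /= ji] _.
by rewrite PP' ?QQ' // (leq_trans _ ik) ?leq_subr.
Qed.

Lemma eqmodXZ k b P P' : eqmodX k P P' -> eqmodX k (b *: P) (b *: P').
Proof. by move=> PP' i ik; rewrite !coefZ PP'. Qed.

Lemma eqmodXX k n P P' : eqmodX k P P' -> eqmodX k (P ^+ n) (P' ^+ n).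
Proof.
by move=> PP'; elim: n => [|n IHn] //; rewrite !exprS; apply: eqmodXM.
Qed.

Lemma eqmodX_sum k n (F G : nat -> {poly S}) : (forall i, eqmodX k (F i) (G i)) ->
  eqmodX k (\sum_(i < n) F i) (\sum_(i < n) G i).
Proof.
move=> FG; elim: n => [|n IHn]; first by rewrite !big_ord0.
by rewrite !big_ord_recr; apply: eqmodXD.
Qed.

Lemma coefX_lt s m i : s`_0 = 0 -> (i < m)%N -> (s ^+ m)`_i = 0.
Proof.
move=> s0; elim: m i => // m IHm i im; rewrite exprS coefM big1 // => -[[|j] /= ji] _.
  by rewrite s0 mul0r.
by rewrite IHm ?mulr0 //; lia.
Qed.

(** A truncated series with exponents [e], composed with [s]. *)
Definition psum n a e s := \sum_(i < n.+1) a i *: s ^+ e i.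

(** As [s] has no constant term, [s ^+ e i] starts in degree at least [e i >= i], so terms beyond
    index [k] do not reach the first [k + 1] coefficients. *)
Lemma psum_eqmodX k n m a e s s' : (forall i, i <= e i)%N -> s`_0 = 0 ->
  (k <= n)%N -> (k <= m)%N -> eqmodX k s s' ->
  eqmodX k (psum n a e s) (psum m a e s').
Proof.
move=> le_e s0 kn km ss'.
have trunc l (r : {poly S}) : r`_0 = 0 -> (k <= l)%N -> eqmodX k (psum l a e r) (psum k a e r).
  move=> r0 kl i ik; rewrite /psum -[l in LHS](subnKC kl) -addSn big_split_ord /=.
  rewrite coefD -[RHS]addr0; congr (_ + _); rewrite coef_sum big1 // => j _.
  by rewrite coefZ coefX_lt ?mulr0 // (leq_trans _ (le_e _)) // ltnS (leq_trans ik) ?leq_addr.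
move=> i ik; rewrite !trunc // -?ss' //.
apply: (@eqmodX_sum k k.+1 (fun j => a j *: s ^+ e j) (fun j => a j *: s' ^+ e j)) => //.
by move=> j; apply/eqmodXZ/eqmodXX.
Qed.

Lemma coef0_psum n a e s : (forall i, i <= e i)%N -> s`_0 = 0 -> e 0%N = 0%N ->
  (psum n a e s)`_0 = a 0%N.
Proof.
move=> le_e s0 e0; rewrite (@psum_eqmodX 0 n 0 a e s s) //.
by rewrite /psum big_ord1 e0 expr0 coefZ coef1 mulr1.
Qed.

Lemma coef0_psum_eq0 n a e s : (forall i, i < e i)%N -> s`_0 = 0 ->
  (psum n a e s)`_0 = 0.
Proof.
move=> lt_e s0; rewrite coef_sum big1 // => i _.
by rewrite coefZ coefX_lt ?mulr0 // (leq_ltn_trans _ (lt_e _)).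
Qed.

Variable c : rat -> S.

(** For [w] = theta^2 the next two series are those of cos(theta s) and sin(theta s) / theta. *)
Definition cos_series n w s := psum n (fun i => c (cos_coef i) * w ^+ i) double s.
Definition sin_series n w s :=
  psum n (fun i => c (sin_coef i) * w ^+ i) (fun i => i.*2.+1) s.
(** Geometric series for 1/s, where [b] is the inverse of the constant term of [s]; no other inverse
    is taken, so any commutative ring will do. *)
Definition inv_series n b s := b *: psum n (fun=> 1) id (1 - b *: s).

Lemma cos_series_eqmodX k n m w s s' : s`_0 = 0 -> (k <= n)%N -> (k <= m)%N ->
  eqmodX k s s' -> eqmodX k (cos_series n w s) (cos_series m w s').
Proof. by apply: psum_eqmodX => i; rewrite -addnn leq_addr. Qed.

Lemma sin_series_eqmodX k n m w s s' : s`_0 = 0 -> (k <= n)%N -> (k <= m)%N ->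
  eqmodX k s s' -> eqmodX k (sin_series n w s) (sin_series m w s').
Proof. by apply: psum_eqmodX => i; rewrite -addnn leqW ?leq_addr. Qed.

Lemma inv_series_eqmodX k n m b s s' : b * s`_0 = 1 -> (k <= n)%N -> (k <= m)%N ->
  eqmodX k s s' -> eqmodX k (inv_series n b s) (inv_series m b s').
Proof.
move=> bs kn km ss'; apply/eqmodXZ/psum_eqmodX => //.
  by rewrite coefB coef1 coefZ bs subrr.
by apply/eqmodXD/eqmodXN/eqmodXZ.
Qed.

End TruncatedSeries.

Section SeriesMorphism.
Variables (S S' : comNzRingType) (f : {rmorphism S -> S'}).
Variables (c : rat -> S) (c' : rat -> S').
Hypothesis fc : forall r, f (c r) = c' r.

Lemma map_psum n a e s :
  map_poly f (psum n a e s) = psum n (fun i => f (a i)) e (map_poly f s).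
Proof.
rewrite /psum rmorph_sum; apply: eq_bigr => i _.
by rewrite /= linearZ /= rmorphXn.
Qed.

Lemma map_cos_series n w s :
  map_poly f (cos_series c n w s) = cos_series c' n (f w) (map_poly f s).
Proof.
rewrite /cos_series map_psum; apply: eq_bigr => i _.
by rewrite rmorphM rmorphXn /= fc.
Qed.

Lemma map_sin_series n w s :
  map_poly f (sin_series c n w s) = sin_series c' n (f w) (map_poly f s).
Proof.
rewrite /sin_series map_psum; apply: eq_bigr => i _.
by rewrite rmorphM rmorphXn /= fc.
Qed.

Lemma map_inv_series n b s :
  map_poly f (inv_series n b s) = inv_series n (f b) (map_poly f s).
Proof.
rewrite /inv_series map_polyZ map_psum /psum; congr (_ *: _).
have -> : map_poly f (1 - b *: s) = 1 - f b *: map_poly f s.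
  by rewrite rmorphB rmorph1 /= map_polyZ.
by apply: eq_bigr => i _; rewrite rmorph1.
Qed.

End SeriesMorphism.

(** * Asymptotic expansions of real functions at zero *)

Section Expansions.
Local Open Scope classical_set_scope.
Local Open Scope ring_scope.
Variable R : realType.
Implicit Types (f g : R -> R) (P Q s : {poly R}).

Definition expands N f P := forall e : R, 0 < e ->
  \forall t \near (0 : R), `|f t - P.[t]| <= e * `|t| ^+ N.

Lemma expandsP N f P :
  expands N f P <-> (fun t => f t - P.[t]) =o_ (0 : R) (fun t => t ^+ N).
Proof.
split=> [fP|/eqoP fP].
  by apply/eqoP => e e0; near do rewrite normrX; exact: fP.
by move=> e e0; near do rewrite -normrX; exact: fP.
Unshelve. all: by end_near.
Qed.

Lemma near_norm_lt (e : R) : 0 < e -> \forall t \near (0 : R), `|t| < e.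
Proof. by move=> e0; near do rewrite -[X in `|X|]subr0 distrC; exact: nbhsx_ballx. 
Unshelve. all: by end_near.
Qed.

Lemma horner_bounded P : exists2 M : R, 0 < M &
  forall t, `|t| <= 1 -> `|P.[t]| <= M.
Proof.
exists (1 + \sum_(i < size P) `|P`_i|); first by rewrite ltr_wpDr ?sumr_ge0.
move=> t t1; rewrite horner_coef (le_trans (ler_norm_sum _ _ _)) //.
rewrite (@le_trans _ _ (\sum_(i < size P) `|P`_i|)) ?lerDr //.
by apply: ler_sum => i _; rewrite normrM normrX ler_piMr // exprn_ile1.
Qed.

Lemma expands_bigO N f P (M : R) :
  (\forall t \near (0 : R), `|f t - P.[t]| <= M * `|t| ^+ N.+1) -> expands N f P.
Proof.
move=> fP e e0; pose M' := 1 + `|M|.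
have M'0 : 0 < M' by rewrite ltr_wpDr.
near=> t.
have tM : `|t| < e / M' by near: t; apply/near_norm_lt/divr_gt0.
apply: (le_trans (near fP t _)) => //; rewrite exprS mulrA ler_wpM2r ?exprn_ge0 //.
rewrite (le_trans (ler_norm _)) // normrM normr_id.
rewrite (@le_trans _ _ (M' * `|t|)) ?ler_wpM2r ?lerDr //.
by rewrite mulrC -ler_pdivlMr // ltW.
Unshelve. all: by end_near.
Qed.

Lemma expands_horner N P Q : eqmodX N P Q -> expands N (horner P) Q.
Proof.
move=> PQ; have [M M0 MP] := horner_bounded (drop_poly N.+1 (P - Q)).
apply: (@expands_bigO _ _ _ M); near=> t.
have t1 : `|t| <= 1 by rewrite ltW //; near: t; exact: near_norm_lt.
rewrite -hornerN -hornerD -(poly_take_drop N.+1 (P - Q)) hornerD.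
rewrite (_ : take_poly _ _ = 0); last first.
  apply/polyP => i; rewrite coef_take_poly coef0 ltnS; case: ifP => // iN.
  by rewrite coefB PQ ?subrr.
rewrite horner0 add0r hornerM hornerXn normrM normrX ler_wpM2r ?exprn_ge0 //.
exact: MP.
Unshelve. all: by end_near.
Qed.

Lemma expandsD N f g P Q : expands N f P -> expands N g Q ->
  expands N (fun t => f t + g t) (P + Q).
Proof.
move=> fP gQ e e0; near=> t.
rewrite hornerD opprD addrACA (le_trans (ler_normD _ _)) //.
rewrite (splitr e) mulrDl lerD //; near: t; [apply: fP|apply: gQ]; exact: divr_gt0.
Unshelve. all: by end_near.
Qed.

Lemma expandsZ N a f P : expands N f P -> expands N (fun t => a * f t) (a *: P).
Proof.
move=> fP e e0; pose a' := 1 + `|a|; have a'0 : 0 < a' by rewrite ltr_wpDr.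
near=> t; rewrite hornerZ -mulrBr normrM.
rewrite (@le_trans _ _ (a' * (e / a' * `|t| ^+ N))) //; last first.
  by rewrite mulrCA mulrA divfK ?gt_eqF.
apply: ler_pM => //; first by rewrite lerDr.
by near: t; apply/fP/divr_gt0.
Unshelve. all: by end_near.
Qed.

Lemma expandsN N f P : expands N f P -> expands N (fun t => - f t) (- P).
Proof.
by move=> /(expandsZ (-1)); rewrite scaleN1r; under eq_fun do rewrite mulN1r.
Qed.

Lemma expandsB N f g P Q : expands N f P -> expands N g Q ->
  expands N (fun t => f t - g t) (P - Q).
Proof. by move=> fP /expandsN; apply: expandsD. Qed.

Lemma expandsC N (a : R) : expands N (fun=> a) a%:P.
Proof.
rewrite (_ : (fun=> a) = horner a%:P); first exact: expands_horner.
by apply/funext => t; rewrite hornerC.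
Qed.

Lemma expands_eqmodX N f P Q : eqmodX N P Q -> expands N f P -> expands N f Q.
Proof.
move=> PQ fP; have := expandsD fP (expandsB (expands_horner PQ) (expands_horner (fun _ _ => erefl) : expands N (horner P) P)).
rewrite addrC subrK; suff -> : (fun t => f t + (P.[t] - P.[t])) = f by [].
by apply/funext => t; rewrite subrr addr0.
Qed.

Lemma expands_near N f g P : (\forall t \near (0 : R), f t = g t) ->
  expands N f P -> expands N g P.
Proof.
move=> fg fP e e0; near=> t; rewrite -(near fg t) //; near: t; exact: fP.
Unshelve. all: by end_near.
Qed.

Lemma expands_bounded N f P : expands N f P ->
  exists2 M : R, 0 < M & \forall t \near (0 : R), `|f t| <= M.
Proof.
move=> fP; have [M M0 PM] := horner_bounded P.
exists (1 + M); first exact: addr_gt0.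
near=> t; have t1 : `|t| <= 1 by rewrite ltW //; near: t; exact: near_norm_lt.
rewrite -[f t](subrK P.[t]) (le_trans (ler_normD _ _)) // lerD ?PM //.
apply: (@le_trans _ _ (1 * `|t| ^+ N)); first by near: t; exact: fP.
by rewrite mul1r exprn_ile1.
Unshelve. all: by end_near.
Qed.

Lemma expandsM N f g P Q : expands N f P -> expands N g Q ->
  expands N (fun t => f t * g t) (P * Q).
Proof.
move=> fP gQ e e0.
have [M M0 gM] := expands_bounded gQ; have [M' M'0 PM'] := horner_bounded P.
near=> t; have t1 : `|t| <= 1 by rewrite ltW //; near: t; exact: near_norm_lt.
rewrite hornerM (_ : _ - _ = (f t - P.[t]) * g t + P.[t] * (g t - Q.[t])); last by ring.
rewrite (le_trans (ler_normD _ _)) // !normrM (splitr e) mulrDl lerD //.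
  rewrite (_ : e / 2 * _ = (e / 2 / M * `|t| ^+ N) * M); last first.
    by field; rewrite gt_eqF.
  apply: ler_pM => //; last by near: t.
  by near: t; apply: fP; rewrite !divr_gt0.
rewrite (_ : e / 2 * _ = M' * (e / 2 / M' * `|t| ^+ N)); last first.
  by rewrite mulrCA mulrA divfK ?gt_eqF.
apply: ler_pM => //; first exact: PM'.
by near: t; apply: gQ; rewrite !divr_gt0.
Unshelve. all: by end_near.
Qed.

Lemma expandsX N n f P : expands N f P -> expands N (fun t => f t ^+ n) (P ^+ n).
Proof.
move=> fP; elim: n => [|n IHn]; first by have := expandsC N 1.
by rewrite exprS; under eq_fun do rewrite exprS; apply: expandsM.
Qed.

Lemma expands_cvg N f P : expands N f P -> forall e : R, 0 < e ->
  \forall t \near (0 : R), `|f t - P`_0| <= e.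
Proof.
move=> fP e e0; have [M M0 PM] := horner_bounded (drop_poly 1 P).
near=> t; have t1 : `|t| <= 1 by rewrite ltW //; near: t; exact: near_norm_lt.
rewrite -(subrK P.[t] (f t)) -addrA (le_trans (ler_normD _ _)) // (splitr e) lerD //.
  apply: (@le_trans _ _ (e / 2 * `|t| ^+ N)); first by near: t; apply/fP/divr_gt0.
  by rewrite ler_piMr ?exprn_ile1 // divr_ge0 // ltW.
rewrite -[X in X.[t]](poly_take_drop 1 P) hornerD.
rewrite (_ : take_poly 1 P = (P`_0)%:P); last first.
  by apply/polyP => -[|i]; rewrite coef_take_poly coefC.
rewrite hornerC addrC addKr hornerM hornerXn expr1 normrM.
rewrite (@le_trans _ _ (M * `|t|)) ?ler_wpM2r ?PM // mulrC -ler_pdivlMr // ltW //.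
by near: t; apply: near_norm_lt; rewrite !divr_gt0.
Unshelve. all: by end_near.
Qed.

Lemma expands_neq0 N f P : expands N f P -> P`_0 != 0 ->
  \forall t \near (0 : R), `|P`_0| / 2 <= `|f t|.
Proof.
move=> fP P0; near=> t.
have : `|f t - P`_0| <= `|P`_0| / 2.
  by near: t; apply: (expands_cvg fP); rewrite divr_gt0 ?normr_gt0.
have := ler_normD (P`_0 - f t) (f t); rewrite subrK distrC; lra.
Unshelve. all: by end_near.
Qed.

(** With [Y] the truncated inverse of [P], the product [f t * Y.[t]] is 1 up to o(t^N); dividing by
    [f t], which stays away from zero, keeps the order. *)
Lemma expandsV N f P b : expands N f P -> b * P`_0 = 1 ->
  expands N (fun t => (f t)^-1) (inv_series N b P).
Proof.
move=> fP bP; have P0 : P`_0 != 0.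
  by apply: contraPneq (oner_neq0 R) => P0; rewrite -bP P0 mulr0 eqxx.
set Y := inv_series N b P; have YP : eqmodX N (P * Y) 1.
  have y0 : (1 - b *: P)`_0 = 0 by rewrite coefB coef1 coefZ bP subrr.
  rewrite /Y /inv_series -scalerAr scalerAl; set y := 1 - b *: P.
  rewrite (_ : b *: P = 1 - y); last by rewrite opprB addrC subrK.
  (* The geometric sum telescopes, and [y ^+ N.+1] has no coefficient of index at most [N]. *)
  rewrite (_ : _ * _ = 1 - y ^+ N.+1).
    by move=> i iN; rewrite coefB (coefX_lt y0) ?subr0.
  rewrite -[RHS]opprB subrX1 -mulNr; congr (_ * _); first by rewrite [RHS]opprB.
  by rewrite /psum; apply: eq_bigr => i _; rewrite scale1r.
have fY : expands N (fun t => f t * Y.[t] - 1) 0.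
  rewrite -(subrr 1%:P); apply: expandsB; last exact: expandsC.
  apply: (expands_eqmodX YP); apply: expandsM => //.
  exact: expands_horner.
move=> e e0; have e'0 : 0 < e * (`|P`_0| / 2) by rewrite mulr_gt0 ?divr_gt0 ?normr_gt0.
near=> t.
have ft : `|P`_0| / 2 <= `|f t| by near: t; exact: (expands_neq0 fP).
have ft0 : 0 < `|f t| by rewrite (lt_le_trans _ ft) ?divr_gt0 ?normr_gt0.
rewrite (_ : _ - _ = - (f t * Y.[t] - 1) / f t); last first.
  by field; rewrite -normr_gt0.
rewrite normrM normrN normfV ler_pdivrMr //.
apply: (@le_trans _ _ (e * (`|P`_0| / 2) * `|t| ^+ N)).
  have : `|f t * Y.[t] - 1 - (0 : {poly R}).[t]| <= e * (`|P`_0| / 2) * `|t| ^+ N.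
    by near: t; exact: fY.
  by rewrite horner0 subr0.
by rewrite mulrAC ler_wpM2l ?mulr_ge0 ?exprn_ge0 // ltW.
Unshelve. all: by end_near.
Qed.

(** Two errors are separated: replacing [f] by its polynomial costs o(t^N) by the Lipschitz bound,
    and truncating the trigonometric series costs O(t^(N+1)) because [s] vanishes at zero. *)
Lemma expands_trig N (f : R -> R) s (th : R) : s`_0 = 0 -> expands N f s ->
  expands N (fun t => cos (th * f t)) (cos_series ratr N (th ^+ 2) s) /\
  expands N (fun t => sin (th * f t)) (th *: sin_series ratr N (th ^+ 2) s).
Proof.
move=> s0 fs; have ths := expandsZ th fs.
have hornerE_cos t : (cos_series ratr N (th ^+ 2) s).[t]
    = (cos_poly R N.+1).[(th *: s).[t]].
  rewrite /cos_series /psum /cos_poly !horner_sum; apply: eq_bigr => i _ /=.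
  rewrite !hornerZ horner_exp hornerXn -mulrA; congr (_ * _).
  by rewrite [RHS]exprMn -exprM mul2n.
have hornerE_sin t : (th *: sin_series ratr N (th ^+ 2) s).[t]
    = (sin_poly R N.+1).[(th *: s).[t]].
  rewrite hornerZ /sin_series /psum /sin_poly !horner_sum mulr_sumr.
  apply: eq_bigr => i _ /=; rewrite !hornerZ horner_exp hornerXn [in RHS]exprMn.
  by rewrite -exprM mul2n [th ^+ _.+1]exprS; ring.
have [M M0 sM] := horner_bounded (drop_poly 1 (th *: s)).
have z_le t : `|t| <= 1 -> `|(th *: s).[t]| <= M * `|t|.
  move=> t1; rewrite -(poly_take_drop 1 (th *: s)) (_ : take_poly _ _ = 0); last first.
    by apply/polyP => -[|i]; rewrite coef_take_poly coef0 //= coefZ s0 mulr0.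
  by rewrite add0r hornerM hornerXn expr1 normrM ler_wpM2r ?sM.
have z_exp t m : `|t| <= 1 -> (N.+1 <= m)%N ->
    `|(th *: s).[t]| ^+ m <= M ^+ m * `|t| ^+ N.+1.
  move=> t1 Nm; rewrite (@le_trans _ _ ((M * `|t|) ^+ m)) //.
    by rewrite lerXn2r ?nnegrE ?mulr_ge0 ?z_le // ltW.
  by rewrite exprMn ler_wpM2l ?exprn_ge0 ?(ltW M0) // ler_wiXn2l.
split.
  have E : expands N (fun t => cos (th * f t) - cos (th *: s).[t]) 0.
    move=> e e0; near=> t; rewrite horner0 subr0 (le_trans (cos_lipschitz _ _)) //.
    by near: t; exact: ths.
  rewrite -[X in expands _ _ X]add0r.
  apply: (@expands_near N (fun t => cos (th * f t) - cos (th *: s).[t] + cos (th *: s).[t])).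
    by near=> t; rewrite subrK.
  apply: expandsD E _; apply: (@expands_bigO _ _ _ (M ^+ N.+1.*2)); near=> t.
  have t1 : `|t| <= 1 by rewrite ltW //; near: t; exact: near_norm_lt.
  rewrite hornerE_cos (le_trans (trig_poly_bound _ _).1) // z_exp //.
  by rewrite -addnn leq_addr.
have E : expands N (fun t => sin (th * f t) - sin (th *: s).[t]) 0.
  move=> e e0; near=> t; rewrite horner0 subr0 (le_trans (sin_lipschitz _ _)) //.
  by near: t; exact: ths.
rewrite -[X in expands _ _ X]add0r.
apply: (@expands_near N (fun t => sin (th * f t) - sin (th *: s).[t] + sin (th *: s).[t])).
  by near=> t; rewrite subrK.
apply: expandsD E _; apply: (@expands_bigO _ _ _ (M ^+ N.+1.*2.+1)); near=> t.
have t1 : `|t| <= 1 by rewrite ltW //; near: t; exact: near_norm_lt.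
rewrite hornerE_sin (le_trans (trig_poly_bound _ _).2) // z_exp //.
by rewrite -addnn leqW ?leq_addr.
Unshelve. all: by end_near.
Qed.

End Expansions.

(** * The squared distance as a power series *)

Section SkewTheory.
Variables (A B : comNzRingType) (f : {rmorphism A -> B}).
Variables (w : weights A) (C1 S1 F1 K1 C2 S2 F2 K2 G L : A).

Definition map_weights := Weights (f (w_f2 w)) (f (w_c2 w)) (f (w_T2 w))
  (f (w_rho w)) (f (w_eta w)).

Lemma rmorph_skew_den : f (skew_den w C1 S1 F1 K1 C2 S2 F2 K2 G L)
  = skew_den map_weights (f C1) (f S1) (f F1) (f K1) (f C2) (f S2) (f F2) (f K2) (f G) (f L).
Proof.
by rewrite /skew_den /skew_uv /skew_X !(rmorphB, rmorphD, rmorphM, rmorphXn).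
Qed.

Lemma rmorph_skew_det : f (skew_det w C1 S1 F1 K1 C2 S2 F2 K2 G L)
  = skew_det map_weights (f C1) (f S1) (f F1) (f K1) (f C2) (f S2) (f F2) (f K2) (f G) (f L).
Proof.
by rewrite /skew_det /skew_X !(rmorphB, rmorphD, rmorphM, rmorphXn).
Qed.

(** Algebraic form of a half-turn about a horizontal axis, which reverses latitudes and differences
    of longitudes and keeps the directions. *)
Lemma skew_flip : skew_den w C1 S1 (- F1) K1 C2 S2 (- F2) K2 G (- L)
    = skew_den w C1 S1 F1 K1 C2 S2 F2 K2 G L
  /\ skew_det w C1 S1 (- F1) K1 C2 S2 (- F2) K2 G (- L)
    = skew_det w C1 S1 F1 K1 C2 S2 F2 K2 G L.
Proof. by rewrite /skew_den /skew_det /skew_uv /skew_X; split; ring. Qed.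

Let w' := Weights (w_f2 w) (w_c2 w) (w_T2 w) (- w_rho w) (- w_eta w).

(** The weights [w_rho] and [w_eta] occur only in products with [L]. Changing their signs amounts to
    changing that of tan delta, so this is the reflection in a vertical plane. *)
Lemma skew_conj : skew_den w' C1 S1 F1 K1 C2 S2 F2 K2 G (- L)
    = skew_den w C1 S1 F1 K1 C2 S2 F2 K2 G L
  /\ skew_det w' C1 S1 F1 K1 C2 S2 F2 K2 G (- L)
    = skew_det w C1 S1 F1 K1 C2 S2 F2 K2 G L.
Proof. by rewrite /skew_den /skew_det /skew_uv /skew_X /=; split; ring. Qed.

End SkewTheory.

Lemma cos_seriesN (S : comNzRingType) (c : rat -> S) n w s :
  cos_series c n w (- s) = cos_series c n w s.
Proof.
by rewrite /cos_series /psum; apply: eq_bigr => i _; rewrite /= -!mul2n !exprM sqrrN.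
Qed.

Lemma sin_seriesN (S : comNzRingType) (c : rat -> S) n w s :
  sin_series c n w (- s) = - sin_series c n w s.
Proof.
rewrite /sin_series /psum -sumrN; apply: eq_bigr => i _ /=.
by rewrite !exprS -!mul2n !exprM sqrrN mulNr scalerN.
Qed.

Lemma eqmodX_refl (S : comNzRingType) k (P : {poly S}) : eqmodX k P P.
Proof. by []. Qed.

(** * The distance series over an arbitrary coefficient ring *)

Section Distance.
Variables (R : realType) (p : R) (x : rat).
Local Notation Q := (Qring p).
Local Notation P := (Qgen p).

Definition base_denom : rat := 1 + 7 * x + 4 * x ^+ 2.
Definition sinphi2 : rat := 4 * ((1 - x) * x * (1 + x)) / base_denom.
Definition tandel2 : rat := (1 - x) * (1 + 3 * x) / (x * base_denom).
Definition px2 : rat := (1 + x) * (1 + 3 * x) / 3.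
(** [rhoQ] is sqrt 3 sin phi tan delta and [etaQ] is sqrt 3 sin phi / tan delta, both rational
    multiples of [p]; [tankap_coef] is tan kappa / (sqrt 3 p). *)
Definition rhoQ : Q := qc p (6 * (1 - x) / base_denom) * P.
Definition etaQ : Q := qc p (6 * x / (1 + 3 * x)) * P.
Definition tankap_coef : rat := (x - 1) / ((1 + x) * (1 + 3 * x)).
Definition coskap2 : rat := (1 + x) * (1 + 3 * x) / ((1 + x) * (1 + 3 * x) + (1 - x) ^+ 2).

Definition weightsQ := Weights (qc p sinphi2) (qc p (1 - sinphi2)) (qc p tandel2) rhoQ etaQ.

Section Generic.
Variables (S : comNzRingType) (c : Q -> S).
Implicit Types (n : nat) (e g s : Q) (a : angle -> {poly S}).

Local Notation cc r := (c (qc p r)).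
Local Notation cosn := (cos_series (fun r => cc r)).
Local Notation sinn := (sin_series (fun r => cc r)).

Definition weightsP := Weights (cc sinphi2)%:P (cc (1 - sinphi2))%:P (cc tandel2)%:P
  (c rhoQ)%:P (c etaQ)%:P.

(** Addition formulas with the normalization constants tan delta * p, sin phi cos phi and sqrt 3:
    cosines and sines of the perturbed directions and latitudes, divided by their base values.
    [coslam] is the cosine of the perturbed difference of longitudes and [sinlam] its sine divided
    by sqrt 3; [g] and [s] are their base values, and [e] is the sign of the hemisphere. *)
Definition cosdel n a : {poly S} :=
  cosn n (cc (tandel2 * px2)) (a Del) - c (qc p tandel2 * P) *: sinn n (cc (tandel2 * px2)) (a Del).
Definition sindel n a : {poly S} :=
  cosn n (cc (tandel2 * px2)) (a Del) + c P *: sinn n (cc (tandel2 * px2)) (a Del).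
Definition sinphi n e a : {poly S} := c e *: (cosn n (cc (sinphi2 * (1 - sinphi2))) (a Phi)
  + cc (1 - sinphi2) *: sinn n (cc (sinphi2 * (1 - sinphi2))) (a Phi)).
Definition cosphi n a : {poly S} :=
  cosn n (cc (sinphi2 * (1 - sinphi2))) (a Phi) - cc sinphi2 *: sinn n (cc (sinphi2 * (1 - sinphi2))) (a Phi).
Definition dlam e1 e2 a1 a2 : {poly S} := c e1 *: a1 Kap - c e2 *: a2 Kap.
Definition coslam n g s m : {poly S} :=
  c g *: cosn n (cc 3) m + (cc 3 * c s) *: sinn n (cc 3) m.
Definition sinlam n g s m : {poly S} :=
  c s *: cosn n (cc 3) m - c g *: sinn n (cc 3) m.

Definition den0 e1 e2 g s : Q := skew_den weightsQ 1 1 e1 1 1 1 e2 1 g s.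

Definition den_series n e1 e2 g s a1 a2 : {poly S} := skew_den weightsP
  (cosdel n a1) (sindel n a1) (sinphi n e1 a1) (cosphi n a1)
  (cosdel n a2) (sindel n a2) (sinphi n e2 a2) (cosphi n a2)
  (coslam n g s (dlam e1 e2 a1 a2)) (sinlam n g s (dlam e1 e2 a1 a2)).

Definition det_series n e1 e2 g s a1 a2 : {poly S} := skew_det weightsP
  (cosdel n a1) (sindel n a1) (sinphi n e1 a1) (cosphi n a1)
  (cosdel n a2) (sindel n a2) (sinphi n e2 a2) (cosphi n a2)
  (coslam n g s (dlam e1 e2 a1 a2)) (sinlam n g s (dlam e1 e2 a1 a2)).

(** The factor [tandel2] is the square of the factor [T] of [skew_scale]; the powers of cos delta
    cancel. *)
Definition sqdist_series n e1 e2 g s a1 a2 : {poly S} :=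
  cc tandel2 *: (det_series n e1 e2 g s a1 a2 ^+ 2
            * inv_series n (c (qinv (den0 e1 e2 g s))) (den_series n e1 e2 g s a1 a2)).

End Generic.

Section Naturality.
Variables (S S' : comNzRingType) (c : Q -> S) (f : {rmorphism S -> S'}).

(** Only ring operations are applied to values of [c]; the inverse is taken in Q[p] beforehand. *)
Lemma map_sqdist_series n e1 e2 g s a1 a2 :
  map_poly f (sqdist_series c n e1 e2 g s a1 a2)
  = sqdist_series (f \o c) n e1 e2 g s (fun u => map_poly f (a1 u)) (fun u => map_poly f (a2 u)).
Proof.
have fcos := @map_cos_series _ _ f (fun r => c (qc p r)) (fun r => f (c (qc p r))) (fun=> erefl).
have fsin := @map_sin_series _ _ f (fun r => c (qc p r)) (fun r => f (c (qc p r))) (fun=> erefl).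
rewrite /sqdist_series map_polyZ (rmorphM (map_poly f)) rmorphXn /= map_inv_series.
rewrite /det_series /den_series rmorph_skew_det rmorph_skew_den.
rewrite /map_weights /weightsP /= !map_polyC.
rewrite /cosdel /sindel /sinphi /cosphi /coslam /sinlam /dlam.
rewrite !map_polyZ !(rmorphB (map_poly f), rmorphD (map_poly f)) /= !map_polyZ.
by rewrite !fcos !fsin !(rmorphB (map_poly f)) /= !map_polyZ (rmorphM f).
Qed.

End Naturality.

Section Truncation.
Variables (S : comNzRingType) (c : {rmorphism Q -> S}).
Implicit Types (n : nat) (e g s : Q) (a : angle -> {poly S}).
Local Notation cc r := (c (qc p r)).

Let coef0_cos n w (s : {poly S}) : s`_0 = 0 ->
  (cos_series (fun r => cc r) n w s)`_0 = 1.
Proof.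
move=> s0; rewrite /cos_series coef0_psum // => [|i]; last by rewrite -addnn leq_addr.
by rewrite /cos_coef fact0 !expr0 divr1 !rmorph1 mulr1.
Qed.

Let coef0_sin n w (s : {poly S}) : s`_0 = 0 ->
  (sin_series (fun r => cc r) n w s)`_0 = 0.
Proof.
by move=> s0; rewrite /sin_series coef0_psum_eq0 // => i; rewrite ltnS -addnn leq_addr.
Qed.

Lemma coef0_den_series n e1 e2 g s a1 a2 :
  (forall u, (a1 u)`_0 = 0) -> (forall u, (a2 u)`_0 = 0) ->
  (den_series c n e1 e2 g s a1 a2)`_0 = c (den0 e1 e2 g s).
Proof.
move=> a10 a20; have m0 : (dlam c e1 e2 a1 a2)`_0 = 0.
  by rewrite coefB !coefZ a10 a20 !mulr0 subrr.
rewrite /den_series -[LHS]/(coefp 0 _) rmorph_skew_den /= /den0 rmorph_skew_den.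
rewrite /map_weights /= !coefC /= rmorph1.
rewrite /cosdel /sindel /sinphi /cosphi /coslam /sinlam.
rewrite !(coefB, coefD, coefZ) !coef0_cos // !coef0_sin //.
by rewrite !(mulr0, mulr1, subr0, addr0).
Qed.

Lemma sqdist_series_eqmodX k n m e1 e2 g s a1 a2 b1 b2 :
  c (qinv (den0 e1 e2 g s)) * c (den0 e1 e2 g s) = 1 ->
  (k <= n)%N -> (k <= m)%N ->
  (forall u, (a1 u)`_0 = 0) -> (forall u, (a2 u)`_0 = 0) ->
  (forall u, eqmodX k (a1 u) (b1 u)) -> (forall u, eqmodX k (a2 u) (b2 u)) ->
  eqmodX k (sqdist_series c n e1 e2 g s a1 a2) (sqdist_series c m e1 e2 g s b1 b2).
Proof.
move=> den0V kn km a10 a20 ab1 ab2.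
have mE : eqmodX k (dlam c e1 e2 a1 a2) (dlam c e1 e2 b1 b2).
  by apply/eqmodXD/eqmodXN; apply/eqmodXZ.
have m0 : (dlam c e1 e2 a1 a2)`_0 = 0.
  by rewrite coefB !coefZ a10 a20 !mulr0 subrr.
have cosE w (a b : {poly S}) : a`_0 = 0 -> eqmodX k a b -> eqmodX k
    (cos_series (fun r => cc r) n w a) (cos_series (fun r => cc r) m w b).
  by move=> a0 ab; apply: cos_series_eqmodX.
have sinE w (a b : {poly S}) : a`_0 = 0 -> eqmodX k a b -> eqmodX k
    (sin_series (fun r => cc r) n w a) (sin_series (fun r => cc r) m w b).
  by move=> a0 ab; apply: sin_series_eqmodX.
have CE a b : (forall u, (a u)`_0 = 0) -> (forall u, eqmodX k (a u) (b u)) ->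
    eqmodX k (cosdel c n a) (cosdel c m b).
  move=> a0 ab; rewrite /cosdel; apply: eqmodXD; first exact: cosE.
  by apply/eqmodXN/eqmodXZ/sinE.
have SE a b : (forall u, (a u)`_0 = 0) -> (forall u, eqmodX k (a u) (b u)) ->
    eqmodX k (sindel c n a) (sindel c m b).
  move=> a0 ab; rewrite /sindel; apply: eqmodXD; first exact: cosE.
  by apply/eqmodXZ/sinE.
have FE e a b : (forall u, (a u)`_0 = 0) -> (forall u, eqmodX k (a u) (b u)) ->
    eqmodX k (sinphi c n e a) (sinphi c m e b).
  move=> a0 ab; rewrite /sinphi; apply/eqmodXZ/eqmodXD; first exact: cosE.
  by apply/eqmodXZ/sinE.
have KE a b : (forall u, (a u)`_0 = 0) -> (forall u, eqmodX k (a u) (b u)) ->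
    eqmodX k (cosphi c n a) (cosphi c m b).
  move=> a0 ab; rewrite /cosphi; apply: eqmodXD; first exact: cosE.
  by apply/eqmodXN/eqmodXZ/sinE.
have GE (a b : {poly S}) : a`_0 = 0 -> eqmodX k a b ->
    eqmodX k (coslam c n g s a) (coslam c m g s b).
  move=> a0 ab; rewrite /coslam; apply: eqmodXD; apply: eqmodXZ; first exact: cosE.
  exact: sinE.
have LE (a b : {poly S}) : a`_0 = 0 -> eqmodX k a b ->
    eqmodX k (sinlam c n g s a) (sinlam c m g s b).
  move=> a0 ab; rewrite /sinlam; apply: eqmodXD; first by apply/eqmodXZ/cosE.
  by apply/eqmodXN/eqmodXZ/sinE.
have XX (A B : {poly S}) : eqmodX k A B -> eqmodX k (A ^+ 2) (B ^+ 2) by exact: eqmodXX.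
rewrite /sqdist_series; apply/eqmodXZ/eqmodXM.
  apply: XX; rewrite /det_series /skew_det /skew_X.
  by repeat first [exact: CE|exact: SE|exact: FE|exact: KE|exact: GE|exact: LE
    |exact: eqmodX_refl|apply: eqmodXD|apply: eqmodXN|apply: eqmodXM].
apply: inv_series_eqmodX => //; first by rewrite coef0_den_series.
rewrite /den_series /skew_den /skew_uv /skew_X.
by repeat first [exact: CE|exact: SE|exact: FE|exact: KE|exact: GE|exact: LE
  |exact: eqmodX_refl|apply: XX|apply: eqmodXD|apply: eqmodXN|apply: eqmodXM].
Qed.

Lemma sqdist_series_flip n e1 e2 g s a1 a2 :
  sqdist_series c n (- e1) (- e2) g (- s) a1 a2 = sqdist_series c n e1 e2 g s a1 a2.
Proof.
have mN : dlam c (- e1) (- e2) a1 a2 = - dlam c e1 e2 a1 a2.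
  by rewrite /dlam !rmorphN !scaleNr opprD.
have FN e a : sinphi c n (- e) a = - sinphi c n e a by rewrite /sinphi rmorphN scaleNr.
have GN m : coslam c n g (- s) (- m) = coslam c n g s m.
  by rewrite /coslam cos_seriesN sin_seriesN rmorphN mulrN scaleNr scalerN opprK.
have LN m : sinlam c n g (- s) (- m) = - sinlam c n g s m.
  by rewrite /sinlam cos_seriesN sin_seriesN rmorphN scaleNr scalerN opprD.
rewrite /sqdist_series /den_series /det_series /den0 mN !FN GN LN.
by rewrite !(proj1 (skew_flip _ _ _ _ _ _ _ _ _ _ _)) !(proj2 (skew_flip _ _ _ _ _ _ _ _ _ _ _)).
Qed.

(** The generator enters the directions only through coefficients of odd series, so its change of
    sign passes to the perturbations of delta. The signs of [rhoQ] and [etaQ] are absorbed by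
    reversing the longitudes, hence those of [s] and of the perturbations of kappa change too. *)
Lemma sqdist_series_conj (iota : {rmorphism Q -> Q}) n e1 e2 g s a1 a2 :
  p ^+ 2 = ratr px2 -> ~ (exists q : rat, p = ratr q) -> den0 e1 e2 g s != 0 ->
  iota P = - P -> (forall r, iota (qc p r) = qc p r) -> iota e1 = e1 -> iota e2 = e2 ->
  sqdist_series (c \o iota) n e1 e2 g s a1 a2
  = sqdist_series c n e1 e2 (iota g) (- iota s)
      (fun u => if u is Phi then a1 u else - a1 u) (fun u => if u is Phi then a2 u else - a2 u).
Proof.
move=> pE p_irr d0 iotaP iotaq ie1 ie2.
pose sg (a : angle -> {poly S}) u := if u is Phi then a u else - a u.
have ccE : (fun r => (c \o iota) (qc p r)) = (fun r => cc r).
  by apply/funext => r /=; rewrite iotaq.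
have irho : iota rhoQ = - rhoQ.
  by rewrite /rhoQ [LHS](rmorphM iota) iotaq iotaP mulrN.
have ieta : iota etaQ = - etaQ.
  by rewrite /etaQ [LHS](rmorphM iota) iotaq iotaP mulrN.
have wE : weightsP (c \o iota) = Weights (cc sinphi2)%:P (cc (1 - sinphi2))%:P (cc tandel2)%:P
    (- (c rhoQ)%:P) (- (c etaQ)%:P).
  by rewrite /weightsP /= irho ieta !iotaq !rmorphN.
have wQE : map_weights iota weightsQ
    = Weights (qc p sinphi2) (qc p (1 - sinphi2)) (qc p tandel2) (- rhoQ) (- etaQ).
  by rewrite /weightsQ /map_weights /= irho ieta !iotaq.
have d0E : iota (den0 e1 e2 g s) = den0 e1 e2 (iota g) (- iota s).
  rewrite /den0 rmorph_skew_den wQE ie1 ie2 !rmorph1 -[iota s]opprK.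
  by rewrite (proj1 (skew_conj weightsQ _ _ _ _ _ _ _ _ _ _)) opprK.
have qE r : (c \o iota) (qc p r) = cc r by rewrite /= iotaq.
have mE : dlam (c \o iota) e1 e2 a1 a2 = - dlam c e1 e2 (sg a1) (sg a2).
  by rewrite /dlam /= ie1 ie2 !scalerN opprD !opprK.
have CE a : cosdel (c \o iota) n a = cosdel c n (sg a).
  rewrite /cosdel ccE !qE /= cos_seriesN sin_seriesN (rmorphM iota) iotaq iotaP mulrN.
  by rewrite !rmorphN /= scaleNr scalerN.
have SE a : sindel (c \o iota) n a = sindel c n (sg a).
  by rewrite /sindel ccE !qE /= cos_seriesN sin_seriesN iotaP rmorphN scaleNr scalerN.
have FE (e : Q) a : iota e = e -> sinphi (c \o iota) n e a = sinphi c n e (sg a).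
  by rewrite /sinphi ccE !qE /= => ->.
have KE a : cosphi (c \o iota) n a = cosphi c n (sg a).
  by rewrite /cosphi ccE !qE.
have GE m : coslam (c \o iota) n g s (- m) = coslam c n (iota g) (- iota s) m.
  rewrite /coslam ccE !qE /= cos_seriesN sin_seriesN.
  by rewrite rmorphN mulrN scaleNr scalerN.
have LE m : sinlam (c \o iota) n g s (- m) = - sinlam c n (iota g) (- iota s) m.
  rewrite /sinlam ccE !qE /= cos_seriesN sin_seriesN.
  by rewrite rmorphN scaleNr scalerN opprB opprK addrC opprK.
rewrite /sqdist_series /den_series /det_series mE !CE !SE !FE // !KE GE LE wE.
rewrite (proj1 (skew_conj (weightsP c) _ _ _ _ _ _ _ _ _ _)).
rewrite (proj2 (skew_conj (weightsP c) _ _ _ _ _ _ _ _ _ _)).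
by rewrite qE /= (rmorph_qinv pE p_irr) // d0E.
Qed.

End Truncation.
End Distance.

(** * Base configuration: algebra *)

Lemma varpi_def J : varpi J =
  match J with lA => lB | lB => lC | lC => lA | lD => lE | lE => lF | lF => lD end.
Proof. by case: varpiE; case: J. Qed.

Lemma varrho_def J : varrho J =
  match J with lA => lD | lB => lF | lC => lE | lD => lA | lE => lC | lF => lB end.
Proof. by case: varrhoE; case: J. Qed.

Lemma varsigma_def J : varsigma J =
  match J with lA => lA | lB => lC | lC => lB | lD => lF | lE => lE | lF => lD end.
Proof. by case: varsigmaE; case: J. Qed.

Definition eps (J : letter) : rat :=
  match J with lA | lB | lC => 1 | lD | lE | lF => -1 end.

(* The longitude of the vertex [J] of the regular hexagon is [b] with
   [cos b = sqrt 3 * lon_cos J] and [sin b = lon_sin J]. *)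
Definition lon_cos (J : letter) : rat :=
  match J with lA | lF => 1 / 2 | lB | lE => - (1 / 2) | lC | lD => 0 end.
Definition lon_sin (J : letter) : rat :=
  match J with lA | lB => 1 / 2 | lC => -1 | lD => 1 | lE | lF => - (1 / 2) end.

Section Letters.
Variables (R : realType) (p : R) (x : rat).
Local Notation Q := (Qring p).
Local Notation P := (Qgen p).

(** The longitude of [J] in the base configuration has cosine sqrt 3 cos kappa * [xQ J] and sine cos
    kappa * [yQ J]. The factor cos kappa, possibly outside Q[p], occurs squared in [gQ] and [sQ]. *)
Definition xQ J : Q := qelt p (lon_cos J) (eps J * tankap_coef x * lon_sin J).
Definition yQ J : Q := qelt p (lon_sin J) (- (3 * eps J * tankap_coef x * lon_cos J)).
Definition gQ J K : Q := qc p (coskap2 x) * (3 * xQ J * xQ K + yQ J * yQ K).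
Definition sQ J K : Q := qc p (coskap2 x) * (yQ J * xQ K - xQ J * yQ K).

Let h : Q := qc p (1 / 2).

Let h4 : 4 * (h * h) = 1.
Proof.
have -> : 4 = qc p 4 by rewrite rmorph_nat.
by rewrite /h -!rmorphM -(rmorph1 (qc p)); congr (qc p _); field.
Qed.

Lemma qeltD a b a' b' : qelt p a b + qelt p a' b' = qelt p (a + a') (b + b').
Proof. by rewrite /qelt !rmorphD /=; ring. Qed.

Lemma qeltN a b : - qelt p a b = qelt p (- a) (- b).
Proof. by rewrite /qelt !rmorphN /=; ring. Qed.

Lemma qcM_qelt r a b : qc p r * qelt p a b = qelt p (r * a) (r * b).
Proof. by rewrite /qelt !rmorphM /=; ring. Qed.

Let three : 3 = qc p 3 :> Q. Proof. by rewrite rmorph_nat. Qed.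

Let qelt_eq a b a' b' : a = a' -> b = b' -> qelt p a b = qelt p a' b'.
Proof. by move=> -> ->. Qed.

(** Rotation of longitudes by 2 pi / 3, in the coordinates (cos / sqrt 3, sin). *)
Lemma xyQ_varpi J : xQ (varpi J) = - (h * (xQ J + yQ J)) /\
  yQ (varpi J) = h * (3 * xQ J - yQ J).
Proof.
rewrite three varpi_def /xQ /yQ /h.
by split; rewrite !(qcM_qelt, qeltN, qeltD); apply: qelt_eq; case: J; rewrite /=; field.
Qed.

(** The map lam -> 2 pi / 3 - lam on longitudes, in the same coordinates; it exchanges the
    hemispheres. *)
Lemma xyQ_varrho J : xQ (varrho J) = h * (yQ J - xQ J) /\
  yQ (varrho J) = h * (3 * xQ J + yQ J).
Proof.
rewrite three varrho_def /xQ /yQ /h.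
by split; rewrite !(qcM_qelt, qeltN, qeltD); apply: qelt_eq; case: J; rewrite /=; field.
Qed.

Lemma eps_varpi J : eps (varpi J) = eps J.
Proof. by rewrite varpi_def; case: J. Qed.

Lemma eps_varrho J : eps (varrho J) = - eps J.
Proof. by rewrite varrho_def; case: J; rewrite /= ?opprK. Qed.

Lemma eps_varsigma J : eps (varsigma J) = eps J.
Proof. by rewrite varsigma_def; case: J. Qed.

Lemma gsQ_varpi J K : gQ (varpi J) (varpi K) = gQ J K /\ sQ (varpi J) (varpi K) = sQ J K.
Proof.
rewrite /gQ /sQ; have [-> ->] := xyQ_varpi J; have [-> ->] := xyQ_varpi K.
by split; rewrite -[RHS]mul1r -[X in _ = X * _]h4; ring.
Qed.

Lemma gsQ_varrho J K :
  gQ (varrho J) (varrho K) = gQ J K /\ sQ (varrho J) (varrho K) = - sQ J K.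
Proof.
rewrite /gQ /sQ; have [-> ->] := xyQ_varrho J; have [-> ->] := xyQ_varrho K.
by split; rewrite -[RHS]mul1r -[X in _ = X * _]h4; ring.
Qed.

(** The reflection lam -> pi / 3 - lam permutes the vertices of the hexagon but replaces kappa by -
    kappa; [iota] undoes this, as tan kappa is an odd multiple of [p]. *)
Lemma gsQ_varsigma (iota : {rmorphism Q -> Q}) J K :
  iota P = - P -> (forall r, iota (qc p r) = qc p r) ->
  gQ (varsigma J) (varsigma K) = iota (gQ J K) /\
  sQ (varsigma J) (varsigma K) = - iota (sQ J K).
Proof.
move=> iotaP iotaq.
have iota_qelt a b : iota (qelt p a b) = qelt p a (- b).
  by rewrite /qelt rmorphD rmorphM !iotaq iotaP rmorphN mulrN mulNr.
have xyE L : xQ (varsigma L) = h * (iota (xQ L) + iota (yQ L)) /\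
    yQ (varsigma L) = h * (3 * iota (xQ L) - iota (yQ L)).
  rewrite three varsigma_def /xQ /yQ /h !iota_qelt.
  by split; rewrite !(qcM_qelt, qeltN, qeltD); apply: qelt_eq; case: L; rewrite /=; field.
rewrite /gQ /sQ !(rmorphM iota) (rmorphB iota) (rmorphD iota) !(rmorphM iota).
rewrite (rmorph_nat iota) !iotaq; have [-> ->] := xyE J; have [-> ->] := xyE K.
by split; rewrite -[RHS]mul1r -[X in _ = X * _]h4; ring.
Qed.

End Letters.

(** The denominator splits as (1 + T + uv)(1 + T - uv) with T = [tandel2]. On one hemisphere uv is
    affine in [g]; on opposite ones it has a further term z whose square is a polynomial in [g]. *)
Lemma skew_den_neq0 (R : realType) (sinphi2 tandel2 rho eta e1 e2 g s : R) :
  0 < sinphi2 -> sinphi2 < 1 -> 0 < tandel2 -> rho ^+ 2 = 3 * sinphi2 * tandel2 ->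
  g ^+ 2 + 3 * s ^+ 2 = 1 -> e1 ^+ 2 = 1 -> e2 ^+ 2 = 1 ->
  (e1 = e2 -> g != 1) -> (e1 = - e2 -> g * (sinphi2 + tandel2) != tandel2 - sinphi2) ->
  skew_den (Weights sinphi2 (1 - sinphi2) tandel2 rho eta) 1 1 e1 1 1 1 e2 1 g s != 0.
Proof.
move=> sinphi2_gt0 sinphi2_lt1 tandel2_gt0 rho2 gs e1q e2q same opp.
have g_ge : -1 <= g by nra.
have g_le : g <= 1 by nra.
set uv := skew_uv (Weights sinphi2 (1 - sinphi2) tandel2 rho eta) 1 1 e1 1 1 1 e2 1 g s.
rewrite (_ : skew_den _ _ _ _ _ _ _ _ _ _ _ = (1 + tandel2 - uv) * (1 + tandel2 + uv)); last first.
  by rewrite /skew_den -/uv /=; ring.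
have [e12|e12] : e1 = e2 \/ e1 = - e2.
  have /eqP : e1 ^+ 2 = e2 ^+ 2 by rewrite e1q e2q.
  by rewrite eqf_sqr => /orP[] /eqP ->; [left|right].
  have -> : uv = (sinphi2 + tandel2) * g + (1 - sinphi2).
    by rewrite /uv /skew_uv /skew_X /= e12 (_ : sinphi2 * e2 * e2 = sinphi2) ?mulr1; [ring|rewrite -mulrA -expr2 e2q mulr1].
  have g_lt : g < 1 by rewrite lt_neqAle same.
  by rewrite mulf_neq0 // gt_eqF //; nra.
have uvE : uv = (tandel2 - sinphi2) * g + (1 - sinphi2) + 2 * rho * s * e1.
  rewrite /uv /skew_uv /skew_X /= e12 (_ : sinphi2 * - e2 * e2 = - sinphi2); first by ring.
  by rewrite mulrN mulNr -mulrA -expr2 e2q mulr1.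
have sq : (2 * rho * s * e1) ^+ 2 = 4 * (sinphi2 * tandel2) * (1 - g ^+ 2).
  by rewrite (_ : 1 - g ^+ 2 = 3 * s ^+ 2) ?exprMn ?e1q ?rho2; [ring|lra].
(* With f = [sinphi2], the sum is 2 (1 - f) + a + z where a = f (1 - g) + T (1 + g). By the
   inequality of the means, a^2 >= 4 f T (1 - g^2) = z^2. *)
have pos_sum : 0 < 1 + tandel2 + uv.
  have [//|neg] := ltrP 0 (1 + tandel2 + uv).
  rewrite uvE in neg *.
  set z := 2 * rho * s * e1 in neg sq *.
  have a_ge0 : 0 <= sinphi2 * (1 - g) + tandel2 * (1 + g) by nra.
  have zlt : z < - (sinphi2 * (1 - g) + tandel2 * (1 + g)) by nra.
  have : (sinphi2 * (1 - g) + tandel2 * (1 + g)) ^+ 2 < z ^+ 2 by nra.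
  by rewrite sq => H; have := sqr_ge0 (sinphi2 * (1 - g) - tandel2 * (1 + g)); nra.
rewrite mulf_neq0 // ?(gt_eqF pos_sum) //.
(* If the other factor vanishes, then z = f (1 + g) + T (1 - g); the equality case of the means
   forces f (1 + g) = T (1 - g), the excluded value of [g]. *)
apply: contra_neq (opp e12) => dif0.
have zE : 2 * rho * s * e1 = sinphi2 * (1 + g) + tandel2 * (1 - g) by move: dif0; rewrite uvE; lra.
have /eqP : (sinphi2 * (1 + g) - tandel2 * (1 - g)) ^+ 2 = 0.
  by rewrite zE in sq; move: sq => /eqP; rewrite -subr_eq0 => /eqP sq; rewrite -[RHS]sq; ring.
by rewrite sqrf_eq0 => /eqP E; lra.
Qed.

(** * Base configuration: angles *)

Definition base_lon (R : realType) (J : letter) : R :=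
  match J with lA => pi / 6 | lB => 5 * pi / 6 | lC => 3 * pi / 2
    | lD => pi / 2 | lE => 7 * pi / 6 | lF => 11 * pi / 6 end.

Lemma config_lineE (R : realType) J (kap phi del : R) :
  config_line J kap phi del = tangent_line (ratr (eps J) * phi)
    (base_lon R J - ratr (eps J) * kap) del.
Proof. by case: J; rewrite /= ?rmorphN rmorph1 ?mulN1r ?mul1r ?opprK. Qed.

(** The triple angle formula at pi / 2 gives 4 s^3 - 3 s + 1 = (2 s - 1)^2 (s + 1) = 0. *)
Lemma sincos_pi6 (R : realType) :
  sin (pi / 6 : R) = 1 / 2 /\ cos (pi / 6 : R) = Num.sqrt 3 / 2.
Proof.
have pi0 := pi_gt0 R.
have c0 : 0 < cos (pi / 6 : R) by apply: cos_gt0_pihalf; apply/andP; split; lra.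
have s0 : 0 < sin (pi / 6 : R) by apply: sin_gt0_pihalf; apply/andP; split; lra.
have cs := cos2Dsin2 (pi / 6 : R).
have : sin (pi / 6 + (pi / 6 + pi / 6) : R) = 1.
  by rewrite (_ : _ + _ = pi / 2) ?sin_pihalf //; field.
rewrite sinD sinD cosD; set c := cos _ in c0 cs *; set s := sin _ in s0 cs *.
move=> triple; have sE : s = 1 / 2.
  have /eqP : (2 * s - 1) ^+ 2 * (s + 1) = 0.
    have cc : c ^+ 2 = 1 - s ^+ 2 by lra.
    have t3 : 3 * s * c ^+ 2 - s ^+ 3 = 1 by rewrite -[RHS]triple; ring.
    apply: (@etrans _ _ (1 - (3 * s * (1 - s ^+ 2) - s ^+ 3))); first by ring.
    by rewrite -cc t3 subrr.
  rewrite mulf_eq0 (gt_eqF (_ : 0 < s + 1)) ?orbF; last lra.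
  by rewrite sqrf_eq0 => /eqP; lra.
split=> //; apply/eqP; rewrite -(eqrXn2 (n := 2)) ?divr_ge0 ?sqrtr_ge0 ?(ltW c0) //.
by apply/eqP; rewrite exprMn sqr_sqrtr //; move: cs; rewrite sE; lra.
Qed.

Lemma base_lonE (R : realType) J : cos (base_lon R J) = Num.sqrt 3 * ratr (lon_cos J) /\
  sin (base_lon R J) = ratr (lon_sin J).
Proof.
have [s6 c6] := sincos_pi6 R.
have r12 : ratr (1 / 2) = 1 / 2 :> R by rewrite fmorph_div rmorph1 rmorph_nat.
case: J => /=; rewrite ?rmorphN ?r12 ?rmorph1 ?rmorph0.
- by rewrite s6 c6; split; lra.
- rewrite (_ : 5 * pi / 6 = - (pi / 6) + pi); last by field.
  by rewrite cosDpi sinDpi cosN sinN s6 c6; split; lra.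
- rewrite (_ : 3 * pi / 2 = pi / 2 + pi); last by field.
  by rewrite cosDpi sinDpi cos_pihalf sin_pihalf; split; lra.
- by rewrite cos_pihalf sin_pihalf; split; lra.
- rewrite (_ : 7 * pi / 6 = pi / 6 + pi); last by field.
  by rewrite cosDpi sinDpi s6 c6; split; lra.
- rewrite (_ : 11 * pi / 6 = - (pi / 6) + pi + pi); last by field.
  by rewrite !cosDpi !sinDpi cosN sinN s6 c6; split; lra.
Qed.

(** * Identities between the parameters, over any ordered field: they are used both in [rat] and in
    [R] *)

Section RationalParameters.
Variables (F : realFieldType) (x : F).
Hypotheses (x_gt0 : 0 < x) (x_lt1 : x < 1).
Let D := 1 + 7 * x + 4 * x ^+ 2.
Let q := (1 + x) * (1 + 3 * x).

Let D_gt0 : 0 < D.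
Proof. by rewrite /D !addr_gt0 ?mulr_gt0 ?exprn_gt0. Qed.

Let q1_gt0 : 0 < 1 + x.
Proof. by rewrite addr_gt0. Qed.

Let q3_gt0 : 0 < 1 + 3 * x.
Proof. by rewrite addr_gt0 ?mulr_gt0. Qed.

Let x1_gt0 : 0 < 1 - x.
Proof. by rewrite subr_gt0. Qed.

Lemma sinphi2_bounds : 0 < 4 * ((1 - x) * x * (1 + x)) / D < 1.
Proof.
rewrite divr_gt0 ?mulr_gt0 //= ltr_pdivrMr // mul1r /D.
rewrite -subr_gt0 (_ : _ - _ = 1 + 3 * x + 4 * x ^+ 2 + 4 * x ^+ 3); last by ring.
by rewrite !addr_gt0 ?mulr_gt0 ?exprn_gt0.
Qed.

Lemma tandel2_positive : 0 < (1 - x) * (1 + 3 * x) / (x * D).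
Proof. by rewrite divr_gt0 ?mulr_gt0. Qed.

Lemma px2_positive : 0 < q / 3.
Proof. by rewrite divr_gt0 ?mulr_gt0. Qed.

Lemma q_positive : 0 < q.
Proof. by rewrite mulr_gt0. Qed.

(** The relation 1 / (1 + tan^2) = cos^2 for kappa. *)
Lemma coskap2_identity : (1 + 3 * ((x - 1) / q) ^+ 2 * (q / 3))^-1 = q / (q + (1 - x) ^+ 2).
Proof.
have s_gt0 : 0 < q + (1 - x) ^+ 2 by rewrite addr_gt0 ?exprn_gt0 ?mulr_gt0.
have sE : q ^+ 2 + 3 * (x - 1) ^+ 2 * (q / 3) = q * (q + (1 - x) ^+ 2) by field.
rewrite (_ : 1 + _ = (q + (1 - x) ^+ 2) / q); last first.
  by apply: (mulfI (lt0r_neq0 q_positive)); field; rewrite lt0r_neq0 // q_positive.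
by rewrite invf_div.
Qed.

(** The first two factors multiply to - cos (2 kappa), the value of [gQ] for the pairs AE, BF, CD,
    whose hexagon vertices are antipodal; there irrationality of [p] gives nothing. *)
Lemma opposite_identity (f := 4 * ((1 - x) * x * (1 + x)) / D)
    (T := (1 - x) * (1 + 3 * x) / (x * D)) :
  q / (q + (1 - x) ^+ 2) * (3 * ((x - 1) / q) ^+ 2 * (q / 3) - 1) * (f + T) != T - f.
Proof.
have s_gt0 : 0 < q + (1 - x) ^+ 2 by rewrite addr_gt0 ?exprn_gt0 ?mulr_gt0.
rewrite eq_sym -subr_eq0.
rewrite (_ : _ - _ = (1 - x) / (x * D) * (1 + 6 * x + x ^+ 2 * (3 - 2 * x))).
  have y_gt0 : 0 < x ^+ 2 * (3 - 2 * x).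
    rewrite mulr_gt0 ?exprn_gt0 // subr_gt0 (@lt_trans _ _ (2 * 1)) ?ltr_pM2l //.
    by rewrite mulr1 ltr_nat.
  rewrite lt0r_neq0 // mulr_gt0 ?divr_gt0 ?mulr_gt0 //.
  by apply: addr_gt0 y_gt0; rewrite addr_gt0 ?mulr_gt0.
by rewrite /f /T /q /D; field; rewrite -/q -/D !lt0r_neq0.
Qed.

Lemma rho_identity : (6 * (1 - x) / D) ^+ 2 * (q / 3)
  = 3 * ((1 - x) * (1 + 3 * x) / (x * D)) * (4 * ((1 - x) * x * (1 + x)) / D).
Proof. by rewrite /q; field; rewrite !lt0r_neq0. Qed.

Lemma eta_identity : (1 - x) * (1 + 3 * x) / (x * D) * ((6 * x / (1 + 3 * x)) ^+ 2 * (q / 3))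
  = 3 * (4 * ((1 - x) * x * (1 + x)) / D).
Proof. by rewrite /q; field; rewrite !lt0r_neq0. Qed.

Lemma rho_coef_ge0 : 0 <= 6 * (1 - x) / D.
Proof. by rewrite ltW // divr_gt0 ?mulr_gt0. Qed.

Lemma eta_coef_ge0 : 0 <= 6 * x / (1 + 3 * x).
Proof. by rewrite ltW // divr_gt0 ?mulr_gt0. Qed.

End RationalParameters.

Section BaseAngles.
Variables (R : realType) (x : rat).
Hypotheses (x_gt0 : 0 < x) (x_lt1 : x < 1).
Local Notation xR := (ratr x : R).
Local Notation p := (px xR).

Lemma sinphi2_gt0 : 0 < sinphi2 x.
Proof. by case/andP: (sinphi2_bounds x_gt0 x_lt1). Qed.

Lemma sinphi2_lt1 : sinphi2 x < 1.
Proof. by case/andP: (sinphi2_bounds x_gt0 x_lt1). Qed.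

Lemma tandel2_gt0 : 0 < tandel2 x.
Proof. exact: tandel2_positive. Qed.

Lemma px2_gt0 : 0 < px2 x.
Proof. exact: px2_positive. Qed.

Let ratrE := (rmorphM (ratr : rat -> R), rmorphB (ratr : rat -> R), rmorphD (ratr : rat -> R),
  fmorphV (ratr : rat -> R), rmorphXn (ratr : rat -> R), rmorph1 (ratr : rat -> R),
  rmorph_nat (ratr : rat -> R)).

Lemma ratr_sinphi2 : ratr (sinphi2 x) = 4 * ((1 - xR) * xR * (1 + xR)) / (1 + 7 * xR + 4 * xR ^+ 2).
Proof. by rewrite /sinphi2 /base_denom !ratrE. Qed.

Lemma ratr_tandel2 : ratr (tandel2 x) = (1 - xR) * (1 + 3 * xR) / (xR * (1 + 7 * xR + 4 * xR ^+ 2)).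
Proof. by rewrite /tandel2 /base_denom !ratrE. Qed.

Lemma ratr_px2 : ratr (px2 x) = (1 + xR) * (1 + 3 * xR) / 3.
Proof. by rewrite /px2 !ratrE. Qed.

Lemma ratr_tankap_coef : ratr (tankap_coef x) = (xR - 1) / ((1 + xR) * (1 + 3 * xR)).
Proof. by rewrite /tankap_coef !ratrE. Qed.

Lemma ratr_coskap2 : ratr (coskap2 x)
  = (1 + xR) * (1 + 3 * xR) / ((1 + xR) * (1 + 3 * xR) + (1 - xR) ^+ 2).
Proof. by rewrite /coskap2 !ratrE. Qed.

Let ratr_rho : ratr (6 * (1 - x) / base_denom x) = 6 * (1 - xR) / (1 + 7 * xR + 4 * xR ^+ 2).
Proof. by rewrite /base_denom !ratrE. Qed.

Let ratr_eta : ratr (6 * x / (1 + 3 * x)) = 6 * xR / (1 + 3 * xR).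
Proof. by rewrite !ratrE. Qed.

Let xR_gt0 : 0 < xR.
Proof. by rewrite ltr0q. Qed.

Let xR_lt1 : xR < 1.
Proof. by rewrite -(rmorph1 (ratr : rat -> R)) ltr_rat. Qed.

Let ratr_gt0 (r : rat) : 0 < r -> 0 < ratr r :> R. Proof. by rewrite ltr0q. Qed.

Lemma px_sqr : p ^+ 2 = ratr (px2 x).
Proof.
rewrite /px -ratr_px2.
by rewrite sqr_sqrtr // ltW // ratr_gt0 // px2_gt0.
Qed.

Lemma px_gt0 : 0 < p.
Proof.
rewrite /px -ratr_px2.
by rewrite sqrtr_gt0 ratr_gt0 // px2_gt0.
Qed.

Lemma sin_base_phi : [/\ 0 < sin (base_angle xR Phi), 0 < cos (base_angle xR Phi),
  sin (base_angle xR Phi) ^+ 2 = ratr (sinphi2 x) & cos (base_angle xR Phi) ^+ 2 = ratr (1 - sinphi2 x)].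
Proof.
rewrite /=; set r := _ / _; set y := 2 * Num.sqrt r.
have y2 : y ^+ 2 = ratr (sinphi2 x).
  have r4 : 4 * r = ratr (sinphi2 x) by rewrite ratr_sinphi2 -[in RHS]mulrA.
  rewrite exprMn sqr_sqrtr; first by rewrite -r4; ring.
  by rewrite -(pmulr_rge0 _ (ltr0Sn R 3)) r4 ltW // ratr_gt0 // sinphi2_gt0.
have y_ge0 : 0 <= y by rewrite mulr_ge0 ?sqrtr_ge0.
have f_gt0 : 0 < y ^+ 2 by rewrite y2 ratr_gt0 // sinphi2_gt0.
have f_lt1 : y ^+ 2 < 1 by rewrite y2 -(rmorph1 (ratr : rat -> R)) ltr_rat sinphi2_lt1.
have y_gt0 : 0 < y by rewrite lt_def y_ge0 andbT; apply: contraTneq f_gt0 => ->; rewrite expr0n ltxx.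
have y_lt1 : y < 1 by nra.
have y_in : -1 <= y <= 1 by apply/andP; split; lra.
have c2 : 0 < 1 - y ^+ 2 by rewrite subr_gt0.
rewrite asinK ?in_itv //= cos_asin // sqrtr_gt0; split=> //.
by rewrite sqr_sqrtr ?(ltW c2) // y2 [RHS](rmorphB (ratr : rat -> R)) (rmorph1 (ratr : rat -> R)).
Qed.

Definition tandel : R := Num.sqrt (ratr (tandel2 x)).

Lemma tandel_gt0 : 0 < tandel.
Proof. by rewrite sqrtr_gt0 ratr_gt0 // tandel2_gt0. Qed.

Lemma tandel_sqr : tandel ^+ 2 = ratr (tandel2 x).
Proof. by rewrite sqr_sqrtr // ltW // ratr_gt0 // tandel2_gt0. Qed.

Lemma cos_atan_gt0 (y : R) : 0 < cos (atan y).
Proof. by rewrite cos_gt0_pihalf // atan_gtNpi2 atan_ltpi2. Qed.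

Lemma sin_atan (y : R) : sin (atan y) = y * cos (atan y).
Proof. by rewrite -{2}(atanK y) /tan divfK // gt_eqF // cos_atan_gt0. Qed.

Lemma sin_base_del : 0 < cos (base_angle xR Del) /\
  sin (base_angle xR Del) = tandel * cos (base_angle xR Del).
Proof.
by rewrite /= -ratr_tandel2 cos_atan_gt0 sin_atan.
Qed.

Let sqrt3_gt0 : 0 < Num.sqrt 3 :> R.
Proof. by rewrite sqrtr_gt0. Qed.

Let sqrt3_sqr : Num.sqrt 3 ^+ 2 = 3 :> R.
Proof. by rewrite sqr_sqrtr. Qed.

Let sqrt_q : Num.sqrt ((1 + xR) * (1 + 3 * xR)) = Num.sqrt 3 * p.
Proof. by rewrite /px -sqrtrM //; congr Num.sqrt; field. Qed.

Let sin_base_kap_eq : (xR - 1) / Num.sqrt ((1 + xR) * (1 + 3 * xR))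
  = Num.sqrt 3 * ratr (tankap_coef x) * p.
Proof.
have p0 : p != 0 by rewrite gt_eqF // px_gt0.
have s0 : Num.sqrt 3 != 0 :> R by rewrite gt_eqF.
have qE : (1 + xR) * (1 + 3 * xR) = Num.sqrt 3 ^+ 2 * p ^+ 2.
  by rewrite px_sqr sqrt3_sqr ratr_px2; field.
by rewrite sqrt_q ratr_tankap_coef qE; field; rewrite s0 p0.
Qed.

Lemma sin_base_kap : sin (base_angle xR Kap)
    = Num.sqrt 3 * ratr (tankap_coef x) * p * cos (base_angle xR Kap) /\
  cos (base_angle xR Kap) ^+ 2 = ratr (coskap2 x).
Proof.
rewrite sin_atan [base_angle _ _]/=; split; first by rewrite sin_base_kap_eq.
rewrite sin_base_kap_eq cos_atan exprVn sqr_sqrtr; last by rewrite addr_ge0 ?sqr_ge0.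
by rewrite 2!exprMn sqrt3_sqr px_sqr ratr_tankap_coef ratr_px2 ratr_coskap2 coskap2_identity.
Qed.

(** Both sides are nonnegative, so it is enough to compare squares, which are rational functions of
    [x]. *)
Lemma rhoQE : val (rhoQ p x) = Num.sqrt 3 * tandel * sin (base_angle xR Phi).
Proof.
have [s0 _ s2 _] := sin_base_phi; set s := sin _ in s0 s2 *.
have -> : val (rhoQ p x) = ratr (6 * (1 - x) / base_denom x) * p by rewrite /rhoQ (rmorphM val).
rewrite ratr_rho; have r0 := rho_coef_ge0 xR_gt0 xR_lt1.
apply/eqP; rewrite -(eqrXn2 (n := 2)) //; first last.
- by rewrite !mulr_ge0 ?(ltW sqrt3_gt0) ?(ltW tandel_gt0) // ltW.
- by rewrite mulr_ge0 ?(ltW px_gt0).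
apply/eqP; rewrite [LHS]exprMn [RHS]exprMn [in RHS]exprMn sqrt3_sqr tandel_sqr s2 px_sqr ratr_px2 ratr_tandel2 ratr_sinphi2.
exact: rho_identity.
Qed.

Lemma etaQE : tandel * val (etaQ p x) = Num.sqrt 3 * sin (base_angle xR Phi).
Proof.
have [s0 _ s2 _] := sin_base_phi; set s := sin _ in s0 s2 *.
have -> : val (etaQ p x) = ratr (6 * x / (1 + 3 * x)) * p by rewrite /etaQ (rmorphM val).
rewrite ratr_eta; have r0 := eta_coef_ge0 xR_gt0.
apply/eqP; rewrite -(eqrXn2 (n := 2)) //; first last.
- by rewrite mulr_ge0 ?(ltW sqrt3_gt0) // ltW.
- by rewrite mulr_ge0 ?(ltW tandel_gt0) // mulr_ge0 ?(ltW px_gt0).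
apply/eqP; rewrite [LHS]exprMn [X in _ * X = _]exprMn [RHS]exprMn sqrt3_sqr tandel_sqr s2 px_sqr ratr_px2 ratr_tandel2 ratr_sinphi2.
exact: eta_identity.
Qed.

Definition lon J : R := base_lon R J - ratr (eps J) * base_angle xR Kap.

Lemma lonE J : cos (lon J) = Num.sqrt 3 * cos (base_angle xR Kap) * val (xQ p x J) /\
  sin (lon J) = cos (base_angle xR Kap) * val (yQ p x J).
Proof.
have [sk _] := sin_base_kap; have [cb sb] := base_lonE R J.
have [ce se] : cos (ratr (eps J) * base_angle xR Kap) = cos (base_angle xR Kap) /\
    sin (ratr (eps J) * base_angle xR Kap) = ratr (eps J) * sin (base_angle xR Kap).
  by case: (J); rewrite /= ?rmorphN rmorph1 ?mulN1r ?cosN ?sinN ?mul1r.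
rewrite /lon cosB sinB cb sb ce se sk /xQ /yQ !val_qelt.
have -> : ratr (- (3 * eps J * tankap_coef x * lon_cos J))
    = - (3 * ratr (eps J) * ratr (tankap_coef x) * ratr (lon_cos J)) :> R by rewrite rmorphN !rmorphM rmorph_nat.
have -> : ratr (eps J * tankap_coef x * lon_sin J)
    = ratr (eps J) * ratr (tankap_coef x) * ratr (lon_sin J) :> R by rewrite !rmorphM.
by split; ring: sqrt3_sqr.
Qed.

Lemma gsQE J K : val (gQ p x J K) = cos (lon J - lon K) /\
  Num.sqrt 3 * val (sQ p x J K) = sin (lon J - lon K).
Proof.
have [_ ck] := sin_base_kap; have [cJ sJ] := lonE J; have [cK sK] := lonE K.
rewrite cosB sinB cJ sJ cK sK /gQ /sQ !(rmorphM val) (rmorphB val) (rmorphD val) !(rmorphM val) (rmorph_nat val).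
rewrite /= -ck.
by split; ring: sqrt3_sqr.
Qed.

End BaseAngles.

(** * Expansion of the squared distances *)

Lemma expands_skew (R : realType) N (w : weights R)
    (C1 S1 F1 K1 C2 S2 F2 K2 G L : R -> R)
    (PC1 PS1 PF1 PK1 PC2 PS2 PF2 PK2 PG PL : {poly R}) :
  expands N C1 PC1 -> expands N S1 PS1 -> expands N F1 PF1 -> expands N K1 PK1 ->
  expands N C2 PC2 -> expands N S2 PS2 -> expands N F2 PF2 -> expands N K2 PK2 ->
  expands N G PG -> expands N L PL ->
  let wP := Weights (w_f2 w)%:P (w_c2 w)%:P (w_T2 w)%:P (w_rho w)%:P (w_eta w)%:P in
  expands N (fun t => skew_det w (C1 t) (S1 t) (F1 t) (K1 t) (C2 t) (S2 t) (F2 t) (K2 t) (G t) (L t))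
    (skew_det wP PC1 PS1 PF1 PK1 PC2 PS2 PF2 PK2 PG PL) /\
  expands N (fun t => skew_den w (C1 t) (S1 t) (F1 t) (K1 t) (C2 t) (S2 t) (F2 t) (K2 t) (G t) (L t))
    (skew_den wP PC1 PS1 PF1 PK1 PC2 PS2 PF2 PK2 PG PL).
Proof.
move=> eC1 eS1 eF1 eK1 eC2 eS2 eF2 eK2 eG eL wP.
have eX : expands N (fun t => skew_X w (F1 t) (K1 t) (F2 t) (K2 t) (G t))
    (skew_X wP PF1 PK1 PF2 PK2 PG).
  by apply: expandsD; do ![apply: expandsM | exact: expandsC | assumption].
have eU : expands N (fun t => skew_uv w (C1 t) (S1 t) (F1 t) (K1 t) (C2 t) (S2 t) (F2 t) (K2 t) (G t) (L t))
    (skew_uv wP PC1 PS1 PF1 PK1 PC2 PS2 PF2 PK2 PG PL).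
  apply: expandsD; last by do ![exact: expandsC | assumption | apply: expandsM].
  apply: expandsD; first by do ![assumption | apply: expandsM].
  by do ![exact: expandsC | assumption | apply: expandsB | apply: expandsM].
split.
  apply: expandsD; apply: expandsM.
  - by do ![exact: expandsC | assumption | apply: expandsB | apply: expandsM].
  - assumption.
  - by do ![assumption | apply: expandsD | apply: expandsM].
  - exact: expandsB.
by apply: expandsB; [apply: expandsM|exact: expandsX];
  do ![exact: expandsC | assumption | apply: expandsX | apply: expandsD | apply: expandsM].
Qed.

(** * Nonvanishing of the denominator at the base configuration *)

Section Nondegenerate.
Variables (R : realType) (x : rat).
Hypotheses (x_gt0 : 0 < x) (x_lt1 : x < 1).
Local Notation xR := (ratr x : R).
Local Notation p := (px xR).
Hypothesis p_irr : ~ exists q : rat, p = ratr q.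

(** The coordinate along [p] vanishes for lines of one hemisphere and for antipodal vertices of the
    hexagon. *)
Lemma gQ_qelt J K : gQ p x J K = qelt p
  (coskap2 x * (3 * lon_cos J * lon_cos K + lon_sin J * lon_sin K
     + 3 * eps J * eps K * tankap_coef x ^+ 2 * px2 x
        * (lon_sin J * lon_sin K + 3 * lon_cos J * lon_cos K)))
  (3 * coskap2 x * tankap_coef x * (eps K - eps J) * (lon_cos J * lon_sin K - lon_sin J * lon_cos K)).
Proof.
have PP : Qgen p * Qgen p = qc p (px2 x).
  by apply: val_inj; rewrite /= -(px_sqr R x_gt0) expr2.
have three : 3 = qc p 3 :> Qring p by rewrite rmorph_nat.
rewrite /gQ /xQ /yQ /qelt three.
move: (px2 x) (tankap_coef x) (coskap2 x) PP => d t k PP.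
rewrite !(rmorphD (qc p), rmorphB (qc p), rmorphN (qc p), rmorphM (qc p), rmorphXn (qc p)) /=.
by rewrite -PP; ring.
Qed.

Let coskap2_mul : coskap2 x * (1 + 3 * tankap_coef x ^+ 2 * px2 x) = 1.
Proof.
have -> : coskap2 x = (1 + 3 * tankap_coef x ^+ 2 * px2 x)^-1 := esym (coskap2_identity x_gt0 x_lt1).
rewrite mulVf // lt0r_neq0 //.
by apply: ltr_wpDr => //; apply: mulr_ge0 (ltW (px2_gt0 _)) => //; apply: mulr_ge0 (sqr_ge0 _).
Qed.

(** On one hemisphere the shifts by kappa cancel and the longitudes differ by 2 pi / 3 up to sign
    and full turns. *)
Lemma same_side_gQ J K : J != K -> eps J = eps K -> val (gQ p x J K) = - (1 / 2).
Proof.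
move=> JK eJK; rewrite gQ_qelt val_qelt eJK subrr mulr0 mul0r rmorph0 mul0r addr0.
have -> : - (1 / 2) = ratr (- (1 / 2)) :> R by rewrite rmorphN fmorph_div rmorph1 rmorph_nat.
congr ratr.
have e2 : eps J * eps K = 1 by rewrite eJK; case: (K).
have geom : 3 * lon_cos J * lon_cos K + lon_sin J * lon_sin K = - (1 / 2).
  have : [|| J == K, eps J != eps K
      | 3 * lon_cos J * lon_cos K + lon_sin J * lon_sin K == - (1 / 2)].
    by clear; case: J; case: K; vm_compute.
  by rewrite (negPf JK) eJK eqxx => /eqP.
rewrite -(mulrA 3 (eps _) (eps _)) (_ : eps K * eps K = 1); last by case: (K).
rewrite [lon_sin J * _ + _]addrC geom mulr1 -[RHS]mulr1 -[X in _ = _ * X]coskap2_mul.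
by ring.
Qed.

Lemma val_qelt_mul g0 g1 a b : a != 0 ->
  val (qelt p g0 g1) * ratr a = ratr b -> g0 * a = b /\ g1 = 0.
Proof.
move=> a0 E; have /(qelt_eq0 p_irr)[/eqP g0E /eqP g1E] : qelt p (g0 * a - b) (g1 * a) = 0.
  apply: val_inj; rewrite val_qelt rmorph0 (rmorphB (ratr : rat -> R)) /= -E val_qelt.
  by rewrite !(rmorphM (ratr : rat -> R)); ring.
by split; [apply/eqP; rewrite -subr_eq0|apply/eqP; rewrite mulf_eq0 (negPf a0) orbF in g1E].
Qed.

(** Equality would make [gQ p x J K] rational; its coordinate along [p] would vanish, forcing
    antipodal vertices, and [opposite_identity] excludes those. *)
Lemma opposite_side_gQ J K : eps J = - eps K ->
  val (gQ p x J K) * (ratr (sinphi2 x) + ratr (tandel2 x)) != ratr (tandel2 x) - ratr (sinphi2 x).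
Proof.
move=> eJK; apply/negP => /eqP; rewrite gQ_qelt.
rewrite -(rmorphD (ratr : rat -> R)) -(rmorphB (ratr : rat -> R)).
have fT : sinphi2 x + tandel2 x != 0 := lt0r_neq0 (addr_gt0 (sinphi2_gt0 x_gt0 x_lt1) (tandel2_gt0 x_gt0 x_lt1)).
case/(val_qelt_mul fT) => g00 /eqP.
have k_neq0 : coskap2 x != 0.
  by apply: contraPneq (oner_neq0 rat) => k0; rewrite -coskap2_mul k0 mul0r eqxx.
have t_neq0 : tankap_coef x != 0.
  have q_neq0 := lt0r_neq0 (q_positive x_gt0).
  by rewrite /tankap_coef mulf_neq0 ?invr_eq0 // subr_eq0 (lt_eqF x_lt1).
have e2 : eps K - eps J != 0 by rewrite eJK; case: (K).
rewrite mulf_eq0 (mulf_eq0 _ (eps K - eps J)) (negPf e2) (mulf_eq0 _ (tankap_coef x)) (negPf t_neq0).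
rewrite (mulf_eq0 3) (negPf k_neq0) /= => /eqP cross.
have geom : 3 * lon_cos J * lon_cos K + lon_sin J * lon_sin K = -1.
  have : [|| eps J != - eps K, lon_cos J * lon_sin K - lon_sin J * lon_cos K != 0
      | 3 * lon_cos J * lon_cos K + lon_sin J * lon_sin K == -1].
    by clear; case: J; case: K; vm_compute.
  by rewrite -eJK cross !eqxx => /eqP.
have : coskap2 x * (3 * tankap_coef x ^+ 2 * px2 x - 1) * (sinphi2 x + tandel2 x) != tandel2 x - sinphi2 x
  := opposite_identity x_gt0 x_lt1.
rewrite -g00 => /eqP; apply; congr (_ * _); congr (_ * _).
rewrite geom -(mulrA 3 (eps J)) (_ : eps J * eps K = -1); last by rewrite eJK; case: (K).
rewrite [lon_sin J * _ + _]addrC geom.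
by move: (tankap_coef x ^+ 2) (px2 x) => t2 d; ring.
Qed.

Lemma den0_neq0 J K : J != K -> den0 x (qc p (eps J)) (qc p (eps K)) (gQ p x J K) (sQ p x J K) != 0.
Proof.
move=> JK; suff : val (den0 x (qc p (eps J)) (qc p (eps K)) (gQ p x J K) (sQ p x J K)) != 0.
  by apply: contra_neq => ->; rewrite rmorph0.
have wE : map_weights val (weightsQ p x) = Weights (ratr (sinphi2 x)) (1 - ratr (sinphi2 x))
    (ratr (tandel2 x)) (val (rhoQ p x)) (val (etaQ p x)).
  congr Weights; rewrite -[1](rmorph1 (ratr : rat -> R)).
  exact: (rmorphB (ratr : rat -> R) 1 (sinphi2 x)).
rewrite /den0 (rmorph_skew_den val) wE (rmorph1 val).
have [gE sE] := gsQE R x_gt0 x_lt1 J K.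
have [s0 c0 s2 c2] := sin_base_phi R x_gt0 x_lt1.
apply: skew_den_neq0.
- by rewrite ltr0q sinphi2_gt0.
- by rewrite -(rmorph1 (ratr : rat -> R)) ltr_rat sinphi2_lt1.
- by rewrite ltr0q tandel2_gt0.
- by rewrite rhoQE // 2!exprMn s2 tandel_sqr // sqr_sqrtr //; ring.
- by move: (cos2Dsin2 (lon R x J - lon R x K)); rewrite -gE -sE (exprMn 2 (Num.sqrt 3)) sqr_sqrtr.
- by case: (J); rewrite /= ?rmorphN rmorph1 ?sqrrN expr1n.
- by case: (K); rewrite /= ?rmorphN rmorph1 ?sqrrN expr1n.
- move=> /fmorph_inj/(same_side_gQ JK) gJK; apply/eqP => g1.
  have := etrans (esym gJK) g1; lra.
- by move=> eJK; apply: opposite_side_gQ; apply: (fmorph_inj (ratr : rat -> R));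
  rewrite (rmorphN (ratr : rat -> R)); exact: eJK.
Qed.

End Nondegenerate.

Section Expansion.
Local Open Scope classical_set_scope.
Local Open Scope ring_scope.
Variables (R : realType) (x : rat).
Hypotheses (x_gt0 : 0 < x) (x_lt1 : x < 1).
Local Notation xR := (ratr x : R).
Local Notation p := (px xR).
Hypothesis p_irr : ~ exists q : rat, p = ratr q.

(* The factor [p] in the last constant lets the conjugation p |-> -p act on the
   symbols of delta by a change of sign, as on those of kappa. *)
Definition theta (u : angle) : R :=
  match u with
  | Kap => Num.sqrt 3
  | Phi => sin (base_angle xR Phi) * cos (base_angle xR Phi)
  | Del => tandel R x * p
  end.

Lemma theta_neq0 u : theta u != 0.
Proof.
have [s0 c0 _ _] := sin_base_phi R x_gt0 x_lt1.
apply: lt0r_neq0; case: u; first by rewrite sqrtr_gt0.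
  exact: mulr_gt0.
by apply: mulr_gt0; [exact: tandel_gt0|exact: px_gt0].
Qed.

Lemma expands_rotation N (f : R -> R) (s : {poly R}) (th : R) : th != 0 -> s`_0 = 0 -> expands N f s ->
  expands N (fun t => sin (th * f t) / th) (sin_series ratr N (th ^+ 2) s).
Proof.
move=> th0 s0 fs; have [_ /(expandsZ th^-1)] := expands_trig th s0 fs.
rewrite scalerA mulVf // scale1r; under eq_fun do rewrite mulrC; exact.
Qed.

Definition param_series (S : comNzRingType) (sym : letter -> angle -> nat -> S) N J u : {poly S} :=
  \sum_(j < N) sym J u j *: 'X^(j.+1).

Lemma coef0_param_series (S : comNzRingType) (sym : letter -> angle -> nat -> S) N J u :
  (param_series sym N J u)`_0 = 0.
Proof. by rewrite coef_sum big1 // => j _; rewrite coefZ coefXn mulr0. Qed.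

Definition dist_series (S : comNzRingType) (c : Qring p -> S) sym N J K : {poly S} :=
  sqdist_series x c N (qc p (eps J)) (qc p (eps K)) (gQ p x J K) (sQ p x J K)
    (param_series sym N J) (param_series sym N K).

Section Pair.
Variables (N : nat) (par : letter -> angle -> nat -> R) (rem : letter -> angle -> R -> R).
Hypothesis rem_o : forall J u, rem J u =o_ (0 : R) (fun t : R => t ^+ N).

Let c : {rmorphism Qring p -> R} := val.
Let sig J u t : R := \sum_(j < N) par J u j * t ^+ j.+1 + rem J u t.
Let ser J u := param_series par N J u.

Let sig_expands J u : expands N (sig J u) (ser J u).
Proof.
apply/expandsP; rewrite (_ : (fun t => _) = rem J u) //; apply/funext => t.
have -> : (ser J u).[t] = \sum_(j < N) par J u j * t ^+ j.+1.
  by rewrite horner_sum; apply: eq_bigr => j _; rewrite hornerZ hornerXn.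
by rewrite /sig addrAC subrr add0r.
Qed.

Let cosf u J t := cos (theta u * sig J u t).
Let sinf u J t := sin (theta u * sig J u t) / theta u.

(** The functions expanded by [cosdel], [sindel], [sinphi], [cosphi], [coslam] and [sinlam]. *)
Let Cf J t := cosf Del J t - (val (qc p (tandel2 x) * Qgen p)) * sinf Del J t.
Let Sf J t := cosf Del J t + p * sinf Del J t.
Let Ff J t := ratr (eps J) * (cosf Phi J t + ratr (1 - sinphi2 x) * sinf Phi J t).
Let Kf J t := cosf Phi J t - ratr (sinphi2 x) * sinf Phi J t.
Let mf J K t := ratr (eps J) * sig J Kap t - ratr (eps K) * sig K Kap t.
Let Gf J K t := val (gQ p x J K) * cos (theta Kap * mf J K t)
  + (3 * val (sQ p x J K)) * (sin (theta Kap * mf J K t) / theta Kap).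
Let Lf J K t := val (sQ p x J K) * cos (theta Kap * mf J K t)
  - val (gQ p x J K) * (sin (theta Kap * mf J K t) / theta Kap).

Let wts : weights R := Weights (ratr (sinphi2 x)) (ratr (1 - sinphi2 x)) (ratr (tandel2 x))
  (val (rhoQ p x)) (val (etaQ p x)).

Let denf J K t := skew_den wts (Cf J t) (Sf J t) (Ff J t) (Kf J t)
  (Cf K t) (Sf K t) (Ff K t) (Kf K t) (Gf J K t) (Lf J K t).
Let detf J K t := skew_det wts (Cf J t) (Sf J t) (Ff J t) (Kf J t)
  (Cf K t) (Sf K t) (Ff K t) (Kf K t) (Gf J K t) (Lf J K t).

Let th_sqr u : theta u ^+ 2 = match u with Kap => 3 | Phi => ratr (sinphi2 x * (1 - sinphi2 x))
  | Del => ratr (tandel2 x * px2 x) end.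
Proof.
have [_ _ s2 c2] := sin_base_phi R x_gt0 x_lt1.
case: u; rewrite /theta ?sqr_sqrtr // exprMn.
  by rewrite s2 c2 (rmorphM (ratr : rat -> R) (sinphi2 x)).
by rewrite (tandel_sqr R x_gt0 x_lt1) (px_sqr R x_gt0) (rmorphM (ratr : rat -> R) (tandel2 x)).
Qed.

Let sqdistE J K t : denf J K t != 0 ->
  sqdist xR theta par rem N J K t = ratr (tandel2 x) * (detf J K t ^+ 2 / denf J K t).
Proof.
move=> den_neq0; rewrite /sqdist /perturbed_line !config_lineE.
have [sp0 cp0 sp2 cp2] := sin_base_phi R x_gt0 x_lt1.
have [cd0 sdE] := sin_base_del R x.
have [gE sE] := gsQE R x_gt0 x_lt1 J K.
have pa L u : perturbed_angle xR theta par rem N L t u = base_angle xR u + theta u * sig L u t.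
  by [].
have thK u z : sin (theta u * z) = theta u * (sin (theta u * z) / theta u).
  by rewrite mulrCA divff ?mulr1 // theta_neq0.
have CE L : cos (perturbed_angle xR theta par rem N L t Del)
    = cos (base_angle xR Del) * Cf L t.
  rewrite pa cosD sdE thK /Cf rmorphM /= -(tandel_sqr R x_gt0 x_lt1) /cosf /sinf.
  by rewrite {2}/theta; ring.
have SE L : sin (perturbed_angle xR theta par rem N L t Del)
    = cos (base_angle xR Del) * (tandel R x * Sf L t).
  by rewrite pa sinD sdE thK /Sf /cosf /sinf {2}/theta; ring.
have FE L : sin (ratr (eps L) * perturbed_angle xR theta par rem N L t Phi)
    = sin (base_angle xR Phi) * Ff L t.
  transitivity (ratr (eps L) * sin (perturbed_angle xR theta par rem N L t Phi)).
    by case: (L); rewrite /= ?rmorphN rmorph1 ?mulN1r ?sinN ?mul1r.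
  by rewrite pa sinD thK /Ff -cp2 /cosf /sinf {2}/theta; ring.
have KE L : cos (ratr (eps L) * perturbed_angle xR theta par rem N L t Phi)
    = cos (base_angle xR Phi) * Kf L t.
  transitivity (cos (perturbed_angle xR theta par rem N L t Phi)).
    by case: (L); rewrite /= ?rmorphN rmorph1 ?mulN1r ?cosN ?mul1r.
  by rewrite pa cosD thK /Kf -sp2 /cosf /sinf {2}/theta; ring.
pose dl := base_lon R J - ratr (eps J) * perturbed_angle xR theta par rem N J t Kap
  - (base_lon R K - ratr (eps K) * perturbed_angle xR theta par rem N K t Kap).
have dlE : dl = lon R x J - lon R x K - theta Kap * mf J K t.
  by rewrite /dl !pa /lon /mf; ring.
have s3 : Num.sqrt 3 ^+ 2 = 3 :> R by rewrite sqr_sqrtr.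
have GE : cos dl = Gf J K t.
  rewrite dlE cosB -gE -sE thK /Gf.
  by rewrite [X in _ + _ * (X * _)]/theta; ring: s3.
have LE : sin dl = Num.sqrt 3 * Lf J K t.
  rewrite dlE sinB -gE -sE thK /Lf.
  by rewrite [X in _ - _ * (X * _)]/theta; ring.
have [denE detE] := skew_scale (w := wts)
  (f := sin (base_angle xR Phi)) (c := cos (base_angle xR Phi))
  (T := tandel R x) (r := Num.sqrt 3) (cos (base_angle xR Del))
  (Cf J t) (Sf J t) (Ff J t) (Kf J t) (Cf K t) (Sf K t) (Ff K t) (Kf K t) (Gf J K t) (Lf J K t)
  (esym sp2) (esym cp2) (esym (tandel_sqr R x_gt0 x_lt1)) (rhoQE R x_gt0 x_lt1) (etaQE R x_gt0 x_lt1).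
rewrite tangent_line_dist -/dl !CE !SE !FE !KE GE LE denE ?detE; last first.
  by rewrite mulf_neq0 // expf_neq0 // gt_eqF.
rewrite -(tandel_sqr R x_gt0 x_lt1) -/(denf J K t) -/(detf J K t).
by field; rewrite den_neq0 gt_eqF.
Qed.

Lemma expands_sqdist J K : J != K ->
  expands N (sqdist xR theta par rem N J K) (dist_series c par N J K).
Proof.
move=> JK; have d0 := den0_neq0 x_gt0 x_lt1 p_irr JK.
have rc : (fun r => c (qc p r)) = (ratr : rat -> R) by [].
have cosE u L : expands N (cosf u L) (cos_series ratr N (theta u ^+ 2) (ser L u)).
  by apply: (expands_trig _ _ _).1; [exact: coef0_param_series|exact: sig_expands].
have sinE u L : expands N (sinf u L) (sin_series ratr N (theta u ^+ 2) (ser L u)).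
  exact: (expands_rotation (theta_neq0 u) (coef0_param_series _ _ _ _) (sig_expands L u)).
have CE L : expands N (Cf L) (cosdel x c N (ser L)).
  by rewrite /cosdel rc -[c (qc p (tandel2 x * px2 x))](th_sqr Del); apply: expandsB => //; apply: expandsZ.
have SE L : expands N (Sf L) (sindel x c N (ser L)).
  by rewrite /sindel rc -[c (qc p (tandel2 x * px2 x))](th_sqr Del); apply: expandsD => //; apply: expandsZ.
have FE L : expands N (Ff L) (sinphi x c N (qc p (eps L)) (ser L)).
  rewrite /sinphi rc -[c (qc p (sinphi2 x * _))](th_sqr Phi).
  by apply: expandsZ; apply: expandsD => //; apply: expandsZ.
have KE L : expands N (Kf L) (cosphi x c N (ser L)).
  rewrite /cosphi rc -[c (qc p (sinphi2 x * _))](th_sqr Phi).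
  by apply: expandsB => //; apply: expandsZ.
set m := dlam c (qc p (eps J)) (qc p (eps K)) (ser J) (ser K).
have mE : expands N (mf J K) m by apply: expandsB; apply: expandsZ.
have m0 : m`_0 = 0 by rewrite coefB !coefZ !coef0_param_series !mulr0 subrr.
have c3 : c (qc p 3) = 3 by rewrite /= rmorph_nat.
have cosmE := (expands_trig (theta Kap) m0 mE).1.
have sinmE := expands_rotation (theta_neq0 Kap) m0 mE.
rewrite th_sqr in cosmE sinmE.
have GE : expands N (Gf J K) (coslam c N (gQ p x J K) (sQ p x J K) m).
  by rewrite /coslam rc c3; apply: expandsD; apply: expandsZ.
have LE : expands N (Lf J K) (sinlam c N (gQ p x J K) (sQ p x J K) m).
  by rewrite /sinlam rc c3; apply: expandsB; apply: expandsZ.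

set denS := den_series x c N (qc p (eps J)) (qc p (eps K)) (gQ p x J K) (sQ p x J K) (ser J) (ser K).
set detS := det_series x c N (qc p (eps J)) (qc p (eps K)) (gQ p x J K) (sQ p x J K) (ser J) (ser K).
have detE : expands N (detf J K) detS.
  exact: (expands_skew wts (CE J) (SE J) (FE J) (KE J) (CE K) (SE K) (FE K) (KE K) GE LE).1.
have denE : expands N (denf J K) denS.
  exact: (expands_skew wts (CE J) (SE J) (FE J) (KE J) (CE K) (SE K) (FE K) (KE K) GE LE).2.
have den00 : denS`_0 = c (den0 x (qc p (eps J)) (qc p (eps K)) (gQ p x J K) (sQ p x J K)).
  by apply: coef0_den_series => u; apply: coef0_param_series.
have inv0 : c (qinv (den0 x (qc p (eps J)) (qc p (eps K)) (gQ p x J K) (sQ p x J K))) * denS`_0 = 1.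
  by rewrite den00 -rmorphM mulrC (qinvV (px_sqr R x_gt0) p_irr) ?rmorph1.
have denS0 : denS`_0 != 0.
  by apply: contraPneq (oner_neq0 R) => E; rewrite -inv0 E mulr0 eqxx.
(* The distance formula requires a nonzero denominator, which is available only near [t = 0]. *)
apply: (@expands_near _ N (fun t => ratr (tandel2 x) * (detf J K t ^+ 2 / denf J K t))).
  near=> t; rewrite sqdistE // -normr_gt0.
  have : `|denS`_0| / 2 <= `|denf J K t| by near: t; exact: (expands_neq0 denE).
  by apply: lt_le_trans; rewrite divr_gt0 ?normr_gt0.
apply: expandsZ; apply: expandsM; first exact: expandsX.
exact: expandsV.
Unshelve. all: by end_near.
Qed.

End Pair.

End Expansion.

(** * Taylor coefficients *)

Lemma coef_param_series (S : comNzRingType) (sym : letter -> angle -> nat -> S) N J u i :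
  (param_series sym N J u)`_i = if (0 < i <= N)%N then sym J u i.-1 else 0.
Proof.
rewrite coef_sum; case: i => [|i] /=.
  by rewrite big1 // => j _; rewrite coefZ coefXn mulr0.
case: ltnP => iN; last first.
  rewrite big1 // => j _; rewrite coefZ coefXn eqSS eq_sym ltn_eqF ?mulr0 //.
  exact: leq_trans (ltn_ord j) iN.
rewrite (bigD1 (Ordinal iN)) //= coefZ coefXn eqxx mulr1 big1 ?addr0 // => j ji.
by rewrite coefZ coefXn eqSS eq_sym (_ : (j == i :> nat) = false) ?mulr0 //; exact: negPf.
Qed.

Lemma map_param_series (S S' : comNzRingType) (f : {rmorphism S -> S'})
    (sym : letter -> angle -> nat -> S) N J u :
  map_poly f (param_series sym N J u) = param_series (fun J u j => f (sym J u j)) N J u.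
Proof.
rewrite /param_series rmorph_sum; apply: eq_bigr => j _.
by rewrite /= map_polyZ map_polyXn.
Qed.

Lemma eq_littleo (R : realType) (f g e : R -> R) :
  f =1 g -> f =o_ (0 : R) e -> g =o_ (0 : R) e.
Proof. by move=> /funext ->. Qed.

Section SignedSymbols.
Variables (R : realType) (p : R).
Local Notation expr := (expr p).

Definition signed_symb (s : {perm letter}) J u j : expr :=
  if u is Phi then symb p (s J) u j else - symb p (s J) u j.

Lemma Galois_Pi_circ (iota : {rmorphism Qring p -> Qring p}) s : Galois_op iota \o Pi_circ s =1 subst_expr iota (signed_symb s).
Proof.
apply: (@subst_expr_comp _ _ iota idfun iota) => // J u j.
by case: u; rewrite /= ?rmorphN /= subst_expr_symb.
Qed.

End SignedSymbols.

Section TaylorExpressions.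
Local Open Scope classical_set_scope.
Local Open Scope ring_scope.
Variables (R : realType) (x : rat).
Hypotheses (x_gt0 : 0 < x) (x_lt1 : x < 1).
Local Notation xR := (ratr x : R).
Local Notation p := (px xR).
Hypothesis p_irr : ~ exists q : rat, p = ratr q.
Local Notation expr := (expr p).

Let C : {rmorphism Qring p -> expr} := @malgC _ _.

(** Truncation at order [k] makes the expression independent of the order of the perturbation; by
    [dist_series_eqmodX] any higher truncation has the same coefficient. *)
Definition taylor_expr J K k : expr := (dist_series C (symb p) k J K)`_k.

Lemma map_dist_series (S S' : comNzRingType) (c : Qring p -> S) (f : {rmorphism S -> S'}) sym k J K :
  map_poly f (dist_series c sym k J K)
  = dist_series (f \o c) (fun J u j => f (sym J u j)) k J K.
Proof.
have E L : (fun u => map_poly f (param_series sym k L u))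
    = param_series (fun J u j => f (sym J u j)) k L.
  by apply/funext => u; rewrite map_param_series.
by rewrite /dist_series map_sqdist_series !E.
Qed.

Lemma dist_series_eqmodX (S : comNzRingType) (c : {rmorphism Qring p -> S}) sym k N J K :
  J != K -> (k <= N)%N ->
  eqmodX k (dist_series c sym k J K) (dist_series c sym N J K).
Proof.
move=> JK kN; apply: sqdist_series_eqmodX => //.
- rewrite -rmorphM mulrC (qinvV (px_sqr R x_gt0) p_irr) ?rmorph1 //.
  exact: den0_neq0.
- by move=> u; apply: coef0_param_series.
- by move=> u; apply: coef0_param_series.
- by move=> u i ik; rewrite !coef_param_series ik (leq_trans ik kN).
- by move=> u i ik; rewrite !coef_param_series ik (leq_trans ik kN).
Qed.

Lemma eval_taylor_expr par J K k :
  eval_expr par (taylor_expr J K k) = (dist_series (val : Qring p -> R) par k J K)`_k.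
Proof.
have CE : eval_expr par \o C = val by apply/funext => c /=; rewrite eval_exprC.
have symbE : (fun L u j => eval_expr par (symb p L u j)) = par.
  by apply/funext => L; apply/funext => u; apply/funext => j; rewrite eval_expr_symb.
by rewrite /taylor_expr -(coef_map (eval_expr par)) map_dist_series CE symbE.
Qed.

Lemma taylor_expansion_expr :
  taylor_expansion xR (theta R x) (fun _ _ => True) taylor_expr.
Proof.
move=> N par rem rem_o _ J K JK.
have expE := expands_sqdist x_gt0 x_lt1 p_irr par rem_o JK.
pose P := \poly_(k < N.+1) eval_expr par (taylor_expr J K k).
have PE : eqmodX N (dist_series (val : Qring p -> R) par N J K) P.
  move=> i iN; rewrite coef_poly ltnS iN eval_taylor_expr.
  exact/esym/(dist_series_eqmodX (val : {rmorphism Qring p -> R})).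
move/(expands_eqmodX PE)/expandsP: expE; apply: eq_littleo => t.
by rewrite horner_poly.
Qed.

Lemma eval_erase_A par (e : expr) : (forall u j, par lA u j = 0) ->
  eval_expr par (erase_A e) = eval_expr par e.
Proof.
move=> parA; rewrite /erase_A.
apply: (@expr_rmorphism_ext _ _ _ (eval_expr par \o subst_expr idfun _) (eval_expr par)).
  by move=> c; rewrite /= subst_exprC.
move=> J u j; rewrite /= subst_expr_symb eval_expr_symb.
by case: eqP => [->|_]; rewrite ?rmorph0 ?parA ?eval_expr_symb.
Qed.

Lemma taylor_expansion_erase_A :
  taylor_expansion xR (theta R x) keeps_A (fun J K k => erase_A (taylor_expr J K k)).
Proof.
move=> N par rem rem_o [parA _] J K JK.
apply: eq_littleo (taylor_expansion_expr rem_o I JK) => t; congr (_ - _).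
by apply: eq_bigr => k _; rewrite eval_erase_A.
Qed.

Lemma subst_taylor_expr (iota : {rmorphism Qring p -> Qring p}) h J K k :
  subst_expr iota h (taylor_expr J K k) = (dist_series (C \o iota) h k J K)`_k.
Proof.
have CE : subst_expr iota h \o C = C \o iota by apply/funext => c /=; rewrite subst_exprC.
have symbE : (fun L u j => subst_expr iota h (symb p L u j)) = h.
  by apply/funext => L; apply/funext => u; apply/funext => j; rewrite subst_expr_symb.
by rewrite /taylor_expr -(coef_map (subst_expr iota h)) map_dist_series CE symbE.
Qed.

Lemma preserves_varpi : preserves taylor_expr (Pi_perm varpi) varpi.
Proof.
move=> J K k _; rewrite /Pi_perm subst_taylor_expr /taylor_expr /dist_series.
by have [-> ->] := gsQ_varpi p x J K; rewrite !eps_varpi.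
Qed.

Lemma preserves_varrho : preserves taylor_expr (Pi_perm varrho) varrho.
Proof.
move=> J K k _; rewrite /Pi_perm subst_taylor_expr /taylor_expr /dist_series.
have [-> ->] := gsQ_varrho p x J K; rewrite !eps_varrho !(rmorphN (qc p)).
by rewrite sqdist_series_flip.
Qed.

Section Conjugation.
Variable iota : {rmorphism Qring p -> Qring p}.
Hypotheses (iotaP : iota (Qgen p) = - Qgen p) (iotaq : forall r, iota (qc p r) = qc p r).

Lemma preserves_varsigma : preserves taylor_expr (Pi_varsigma iota) varsigma.
Proof.
move=> J K k JK; rewrite /Pi_varsigma Galois_Pi_circ subst_taylor_expr /taylor_expr.
have conj := @sqdist_series_conj R p x _ C iota k _ _ _ _
  (param_series (signed_symb p varsigma) k J) (param_series (signed_symb p varsigma) k K)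
  (px_sqr R x_gt0) p_irr (den0_neq0 x_gt0 x_lt1 p_irr JK) iotaP iotaq
  (iotaq (eps J)) (iotaq (eps K)).
apply: (congr1 (fun P : {poly expr} => P`_k)); apply: etrans conj _; rewrite /dist_series.
have [-> ->] := gsQ_varsigma x J K iotaP iotaq; rewrite !eps_varsigma.
(* The signs produced by the conjugation cancel those of [signed_symb]. *)
have serE L : (fun u => if u is Phi then param_series (signed_symb p varsigma) k L u
    else - param_series (signed_symb p varsigma) k L u) = param_series (symb p) k (varsigma L).
  apply/funext => u; rewrite /param_series.
  by case: u => //; rewrite -sumrN; apply: eq_bigr => j _; rewrite /= scaleNr opprK.
apply: f_equal2; [exact: serE J|exact: serE K].
Qed.

End Conjugation.
End TaylorExpressions.

(** * Symmetry groups *)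

(** Cyclic order of the vertices by longitude. *)
Definition hexagon_index (J : letter) : nat :=
  match J with lA => 0 | lD => 1 | lB => 2 | lE => 3 | lC => 4 | lF => 5 end.

Definition adj (J K : letter) : bool :=
  (hexagon_index K == (hexagon_index J).+1 %% 6)%N
  || (hexagon_index J == (hexagon_index K).+1 %% 6)%N.

(* Distinguishes the two triplets AF, CE, BD and AD, BE, CF of sides. *)
Definition side_class (J K : letter) : bool :=
  match J, K with
  | lA, lF | lF, lA | lC, lE | lE, lC | lB, lD | lD, lB => true
  | _, _ => false
  end.

(** Tells whether [s] exchanges the two triplets of sides, [AD] being in the class [false]. On the
    group it is the character deciding whether an operator conjugates coefficients. *)
Definition chi (s : {perm letter}) : bool := side_class (s lA) (s lD).

(** Neighbours are the vertices whose unit vectors have inner product cos (pi / 3). *)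
Lemma adjE J K :
  adj J K = (3 * lon_cos J * lon_cos K + lon_sin J * lon_sin K == 1 / 2).
Proof. by case: J; case: K; vm_compute. Qed.

Section LetterGroup.
Local Open Scope group_scope.

Let hexP (s : {perm letter}) : Prop := (forall J K, adj (s J) (s K) = adj J K) /\
  exists b, forall J K, adj J K -> side_class (s J) (s K) = b (+) side_class J K.

Let hex_set : {set {perm letter}} := [set s | `[< hexP s >]].

Let hex_group_set : group_set hex_set.
Proof.
apply/group_setP; split.
  rewrite inE; apply/asboolP; split=> [J K|]; first by rewrite !perm1.
  by exists false => J K _; rewrite !perm1.
move=> s t sH tH; have /asboolP[sA [b sb]] : `[< hexP s >] by move: sH; rewrite inE.
have /asboolP[tA [c tc]] : `[< hexP t >] by move: tH; rewrite inE.
rewrite inE; apply/asboolP; split=> [J K|]; first by rewrite !permM tA sA.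
exists (c (+) b) => J K JK; rewrite !permM tc ?sA // sb //.
by rewrite addbA.
Qed.

Lemma letter_group_hex s : s \in letter_group -> hexP s.
Proof.
move=> sG; suff /fintype.subsetP/(_ s sG) : letter_group \subset Group hex_group_set.
  by rewrite inE => /asboolP.
rewrite gen_subG; apply/fintype.subsetP => t tS; rewrite inE; apply/asboolP.
move: tS; rewrite !inE => /orP[/orP[]|] /eqP ->; split.
- by move=> J K; rewrite !varpi_def; case: J; case: K.
- by exists false => J K; rewrite !varpi_def; case: J; case: K.
- by move=> J K; rewrite !varrho_def; case: J; case: K.
- by exists false => J K; rewrite !varrho_def; case: J; case: K.
- by move=> J K; rewrite !varsigma_def; case: J; case: K.
- by exists true => J K; rewrite !varsigma_def; case: J; case: K.
Qed.

Lemma varpi_in : varpi \in letter_group.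
Proof. by rewrite mem_gen // !inE eqxx. Qed.

Lemma varrho_in : varrho \in letter_group.
Proof. by rewrite mem_gen // !inE eqxx orbT. Qed.

Lemma varsigma_in : varsigma \in letter_group.
Proof. by rewrite mem_gen // !inE eqxx !orbT. Qed.

(** Walking around the hexagon, each next vertex is the neighbour of the last one not yet passed. *)
Lemma adj_fix (s : {perm letter}) : (forall J K, adj (s J) (s K) = adj J K) ->
  s lA = lA -> s lD = lD -> s = 1.
Proof.
move=> sA a d; have inj J K : J != K -> s J != s K by apply: contra_neq => /perm_inj.
have b : s lB = lB.
  by have := sA lD lB; have := inj lA lB isT; rewrite a d; case: (s lB).
have e : s lE = lE.
  by have := sA lB lE; have := inj lD lE isT; rewrite b d; case: (s lE).
have c : s lC = lC.
  by have := sA lE lC; have := inj lB lC isT; rewrite b e; case: (s lC).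
have f : s lF = lF.
  by have := sA lC lF; have := inj lE lF isT; rewrite c e; case: (s lF).
by apply/permP => J; rewrite perm1; case: J.
Qed.

(** Applying [varsigma] and [varrho] alternately to the oriented side [(A, D)] passes through all
    twelve oriented sides. *)
Lemma letter_group_edge a d : adj a d ->
  exists2 s, s \in letter_group & s lA = a /\ s lD = d.
Proof.
pose reach a d := exists2 s, s \in letter_group & s lA = a /\ s lD = d.
have step t J K : t \in letter_group -> reach J K -> reach (t J) (t K).
  by move=> tG [s sG [<- <-]]; exists (s * t); rewrite ?groupM ?permM.
have sv J K : reach J K -> reach (varsigma J) (varsigma K) by apply/step/varsigma_in.
have rh J K : reach J K -> reach (varrho J) (varrho K) by apply/step/varrho_in.
have AD : reach lA lD by exists 1; rewrite ?group1 ?perm1.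
have AF := sv _ _ AD; rewrite !varsigma_def in AF.
have DB := rh _ _ AF; rewrite !varrho_def in DB.
have FC := sv _ _ DB; rewrite !varsigma_def in FC.
have BE := rh _ _ FC; rewrite !varrho_def in BE.
have CE := sv _ _ BE; rewrite !varsigma_def in CE.
have EC := rh _ _ CE; rewrite !varrho_def in EC.
have EB := sv _ _ EC; rewrite !varsigma_def in EB.
have CF := rh _ _ EB; rewrite !varrho_def in CF.
have BD := sv _ _ CF; rewrite !varsigma_def in BD.
have FA := rh _ _ BD; rewrite !varrho_def in FA.
have DA := sv _ _ FA; rewrite !varsigma_def in DA.
by case: a; case: d.
Qed.

Lemma letter_groupP (s : {perm letter}) : reflect (forall J K, adj (s J) (s K) = adj J K) (s \in letter_group).
Proof.
apply: (iffP idP) => [/letter_group_hex[]//|sA].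
have [|t tG [tA tD]] := @letter_group_edge (s lA) (s lD); first by rewrite sA.
have tadj := (letter_group_hex tG).1.
suff : s * t^-1 = 1 by move/eqP; rewrite -eq_mulgV1 => /eqP ->.
apply: adj_fix => [J K||]; rewrite !permM; last 2 first.
- by rewrite -tA permK.
- by rewrite -tD permK.
by rewrite -tadj !permKV sA.
Qed.

Lemma chiM s t : s \in letter_group -> t \in letter_group -> chi (s * t) = chi s (+) chi t.
Proof.
move=> sG tG; have [sA _] := letter_group_hex sG; have [_ [b tb]] := letter_group_hex tG.
by rewrite /chi !permM !tb ?sA // addbF addbC.
Qed.

Lemma chi1 : chi 1 = false.
Proof. by rewrite /chi !perm1. Qed.

Lemma card_letter_group : #|letter_group| = 12.
Proof.
pose f (s : {perm letter}) := (s lA, s lD).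
have f_inj : {in letter_group &, injective f}.
  move=> s t sG tG [a d]; apply/eqP; rewrite eq_mulgV1; apply/eqP/adj_fix.
  - by move=> J K; apply/letter_groupP; rewrite groupM ?groupV.
  - by rewrite permM a permK.
  - by rewrite permM d permK.
rewrite -(card_in_imset f_inj).
pose sides := [:: (lA, lD); (lD, lA); (lD, lB); (lB, lD); (lB, lE); (lE, lB);
  (lE, lC); (lC, lE); (lC, lF); (lF, lC); (lF, lA); (lA, lF)].
have -> : f @: letter_group = [set z in sides].
  apply/setP => -[a d]; rewrite inE (_ : _ \in sides = adj a d); last by case: a; case: d.
  apply/imsetP/idP => [[s sG [-> ->]]|]; first by rewrite (letter_groupP _ sG).
  by case/letter_group_edge => s sG [<- <-]; exists s.
by rewrite cardsE; apply/card_uniqP.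
Qed.

Lemma letter_group_gen2 : letter_group = <<[set varrho; varsigma]>> :> {set _}.
Proof.
apply/eqP; rewrite finset.eqEsubset !gen_subG; apply/andP.
split; apply/fintype.subsetP => s.
  have rG : varrho \in <<[set varrho; varsigma]>> by rewrite mem_gen // !inE eqxx.
  have sG : varsigma \in <<[set varrho; varsigma]>> by rewrite mem_gen // !inE eqxx orbT.
  rewrite !inE => /orP[/orP[]|] /eqP -> //.
  (* The product of the two reflections is the rotation of the hexagon by pi / 3. *)
  suff -> : varpi = varsigma * varrho * (varsigma * varrho).
    exact: (groupM (groupM sG rG) (groupM sG rG)).
  apply/permP => J; rewrite varpi_def (permM (varsigma * varrho)) !(permM varsigma varrho).
  by case: J; rewrite !(varsigma_def, varrho_def).
by rewrite !inE => /orP[] /eqP ->; rewrite mem_gen // !inE eqxx ?orbT.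
Qed.

Lemma letter_group_dihedral : letter_group \isog 'D_12.
Proof.
have inv2 (s : {perm letter}) : s != 1 -> s * s = 1 -> #[s] = 2.
  by move=> s1 ss; apply: nt_prime_order => //; rewrite expgS expg1.
have := @involutions_gen_dihedral _ varrho varsigma; rewrite /= -letter_group_gen2 card_letter_group.
apply.
- apply: inv2; first by apply/eqP => /permP/(_ lA); rewrite varrho_def perm1.
  by apply/permP => J; rewrite permM perm1 !varrho_def; case: J.
- apply: inv2; first by apply/eqP => /permP/(_ lB); rewrite varsigma_def perm1.
  by apply/permP => J; rewrite permM perm1 !varsigma_def; case: J.
- by apply/eqP => /permP/(_ lA); rewrite varrho_def varsigma_def.
Qed.

End LetterGroup.

(** * The operators and the group that they generate *)

Section OperatorGroup.
Variables (R : realType) (p : R).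
Local Notation expr := (expr p).
Variable iota : {rmorphism Qring p -> Qring p}.
Hypothesis iotaK : involutive iota.

Definition conj_if (b : bool) : {rmorphism Qring p -> Qring p} := if b then iota else idfun.

Definition signed_if (b : bool) (s : {perm letter}) J u j : expr :=
  if b then signed_symb p s J u j else symb p (s J) u j.

Definition operator (s : {perm letter}) : expr -> expr :=
  subst_expr (conj_if (chi s)) (signed_if (chi s) s).

(** Conjugations compose according to [chi] because [iota] is an involution, and the signs of two
    conjugating operators cancel. *)
Lemma operatorM s t : s \in letter_group -> t \in letter_group ->
  operator (s * t)%g = operator t \o operator s.
Proof.
move=> sG tG; apply/esym/funext; apply: subst_expr_comp; rewrite chiM //.
  by move=> c; case: (chi s); case: (chi t); rewrite /= ?iotaK.
move=> J u j; case: (chi s); case: (chi t); case: u;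
  by rewrite /= ?rmorphN /= subst_expr_symb /= permM ?opprK.
Qed.

Lemma operator1 : operator 1%g = id.
Proof.
apply/funext => e; rewrite /operator chi1.
apply: (@subst_expr_id R p idfun (signed_if false 1%g)) => [c|J u j]; first by [].
by rewrite /signed_if perm1.
Qed.

Lemma operator_symb s J u j : operator s (symb p J u j) = signed_if (chi s) s J u j.
Proof. exact: subst_expr_symb. Qed.

Lemma operator_varpi : Pi_perm varpi = operator varpi.
Proof. by rewrite /operator (_ : chi varpi = false) // /chi !varpi_def. Qed.

Lemma operator_varrho : Pi_perm varrho = operator varrho.
Proof. by rewrite /operator (_ : chi varrho = false) // /chi !varrho_def. Qed.

Lemma operator_varsigma : Pi_varsigma iota = operator varsigma.
Proof.
rewrite /operator (_ : chi varsigma = true); last by rewrite /chi !varsigma_def.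
by apply/funext => e; rewrite /Pi_varsigma Galois_Pi_circ.
Qed.

(** Symbols of latitude never acquire a sign, so evaluating them reveals the permutation. *)
Lemma operator_inj : {in letter_group &, injective operator}.
Proof.
move=> s t _ _ st; apply/permP => J.
pose par L (_ : angle) (_ : nat) : R := (L == s J)%:R.
have E r : operator r (symb p J Phi 0%N) = symb p (r J) Phi 0%N.
  by rewrite operator_symb /signed_if; case: (chi r).
have : eval_expr par (operator s (symb p J Phi 0%N)) = eval_expr par (operator t (symb p J Phi 0%N)).
  by rewrite st.
rewrite (E s) (E t) => evE.
have := etrans (esym (eval_expr_symb p par (s J) Phi 0%N))
  (etrans evE (eval_expr_symb p par (t J) Phi 0%N)).
clear E evE st; rewrite /par eqxx.
by have [->|_] := eqVneq (t J) (s J) => // /eqP; rewrite oner_eq0.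
Qed.

Lemma generated_operator f :
  Defs.generated [set Pi_perm varpi; Pi_perm varrho; Pi_varsigma iota]%classic f
  <-> exists2 s, s \in letter_group & f = operator s.
Proof.
split.
  elim=> [|g|g h _ [s sG ->] _ [t tG ->]|g h _ [s sG gE] gK hK].
  - by exists 1%g; rewrite ?group1 ?operator1.
  - case=> [[]|] ->.
    + by exists varpi; [exact: varpi_in|exact: operator_varpi].
    + by exists varrho; [exact: varrho_in|exact: operator_varrho].
    + by exists varsigma; [exact: varsigma_in|exact: operator_varsigma].
  - by exists (t * s)%g; [exact: groupM|exact: esym (operatorM tG sG)].
  - exists s^-1%g; [exact: groupVr|apply/funext => e].
    have gV : g \o operator s^-1%g = id.
      by rewrite gE -(operatorM (groupVr sG) sG) mulVg operator1.
    exact: etrans (congr1 h (esym (congr1 (fun k => k e) gV))) (gK _).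
case=> s sG ->.
pose H := [set s | (s \in letter_group) && `[< Defs.generated
  [set Pi_perm varpi; Pi_perm varrho; Pi_varsigma iota]%classic (operator s)>]]%SET.
have H_group : group_set H.
  apply/group_setP; split.
    rewrite inE group1; apply/asboolP; rewrite operator1; exact: Defs.gen_id.
  move=> r t rH tH; have /andP[rG /asboolP rg] : (r \in letter_group) && `[< Defs.generated
      [set Pi_perm varpi; Pi_perm varrho; Pi_varsigma iota]%classic (operator r)>].
    by move: rH; rewrite inE.
  have /andP[tG /asboolP tg] : (t \in letter_group) && `[< Defs.generated
      [set Pi_perm varpi; Pi_perm varrho; Pi_varsigma iota]%classic (operator t)>].
    by move: tH; rewrite inE.
  rewrite inE (groupM rG tG); apply/asboolP; rewrite (operatorM rG tG).
  exact: Defs.gen_comp.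
suff /fintype.subsetP/(_ s sG) : letter_group \subset Group H_group.
  by rewrite inE => /andP[_ /asboolP].
rewrite gen_subG; apply/fintype.subsetP => t; rewrite !inE => /orP[/orP[]|] /eqP ->.
- by rewrite varpi_in -operator_varpi; apply/asboolP/Defs.gen_in; left; left.
- by rewrite varrho_in -operator_varrho; apply/asboolP/Defs.gen_in; left; right.
- by rewrite varsigma_in -operator_varsigma; apply/asboolP/Defs.gen_in; right.
Qed.

Lemma operator_group_isoP : operator_group_iso iota operator.
Proof.
split; [exact: operatorM|exact: operator_inj|exact: generated_operator|].
move=> s _ J u j; rewrite operator_symb /signed_if.
by case: (chi s); [case: u; [right|left|right]|left].
Qed.

End OperatorGroup.

(** * Isometries preserving the six vertical lines *)

Section HexagonSymmetry.
Variable R : realType.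
Local Notation e3 := (vec3 0 0 1 : 'rV[R]_3).

Definition vertex (J : letter) : 'rV[R]_3 := vec3 (cos (base_lon R J)) (sin (base_lon R J)) 0.

Lemma C6E J : @C6 R J = [set vertex J + t *: e3 | t in setT]%classic.
Proof.
have lineE phi (lam : R) : phi = 0 ->
    tangent_line phi lam 0 = [set vec3 (cos lam) (sin lam) 0 + t *: e3 | t in setT]%classic.
  move=> ->; rewrite /tangent_line; congr image; apply/funext => t; congr (_ + _ *: _).
    by rewrite /sphere_point cos0 sin0 !mul1r.
  by rewrite cos0 sin0 scale1r scale0r addr0 /north sin0 cos0 !mul0r oppr0.
by rewrite /C6 config_lineE lineE ?mulr0 // subr0.
Qed.

Lemma dot3_orthogonal (g : 'M[R]_3) u v : g *m g^T = 1%:M -> dot3 (u *m g) (v *m g) = dot3 u v.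
Proof.
move=> gg; have dotE w z : dot3 w z = (w *m z^T) 0 0.
  by rewrite mxE; apply: eq_bigr => j _; rewrite mxE.
by rewrite !dotE trmx_mul mulmxA -(mulmxA u) gg mulmx1.
Qed.

Lemma dot3_vertex J K : dot3 (vertex J) (vertex K)
  = ratr (3 * lon_cos J * lon_cos K + lon_sin J * lon_sin K).
Proof.
have [cJ sJ] := base_lonE R J; have [cK sK] := base_lonE R K.
rewrite dot3E /vertex !vec3E cJ sJ cK sK mulr0 addr0 rmorphD !rmorphM /= rmorph_nat.
by rewrite mulrACA -expr2 sqr_sqrtr // mulrA.
Qed.

(** An isometry permuting the lines also permutes the vertices, and inner products of vertices
    determine adjacency. *)
Lemma C6_symmetry_adj s : @C6_symmetry R s -> forall J K, adj (s J) (s K) = adj J K.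
Proof.
case=> g gg gC6 J K.
have e3e3 : dot3 e3 e3 = 1 by rewrite dot3E !vec3E !mul0r !add0r mulr1.
have ve3 L : dot3 (vertex L) e3 = 0.
  by rewrite dot3E /vertex !vec3E !mulr0 mul0r !addr0.
have dotD u v w : dot3 (u + v) w = dot3 u w + dot3 v w.
  by rewrite !dot3E !mxE; ring.
have dotZ a u w : dot3 (a *: u) w = a * dot3 u w.
  by rewrite !dot3E !mxE; ring.
have dotZr a u w : dot3 u (a *: w) = a * dot3 u w.
  by rewrite !dot3E !mxE; ring.
have on_line L t : exists t', (vertex L + t *: e3) *m g = vertex (s L) + t' *: e3.
  have : C6 (s L) ((vertex L + t *: e3) *m g).
    by rewrite -gC6; exists (vertex L + t *: e3) => //; rewrite C6E; exists t.
  by rewrite C6E => -[t' _ <-]; exists t'.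
(* A priori a vertex lands anywhere on the image line; since the axis is mapped to itself and
   vertices are orthogonal to it, the vertical offset [a] is zero. *)
have vg L : vertex L *m g = vertex (s L).
  have [a aE] := on_line L 0; have [b bE] := on_line L 1.
  rewrite scale0r addr0 in aE; rewrite scale1r mulmxDl aE in bE.
  have eg : e3 *m g = (b - a) *: e3.
    by rewrite scalerBl; apply: (addrI (vertex (s L) + a *: e3)); rewrite bE -addrA (addrC (a *: e3)) subrK.
  have := dot3_orthogonal e3 e3 gg; rewrite eg dotZ dotZr e3e3 mulr1 => ba.
  have := dot3_orthogonal (vertex L) e3 gg.
  rewrite aE eg ve3 dotD dotZ !dotZr ve3 e3e3 mulr0 add0r mulr1 => aba; have a0 : a = 0.
    by rewrite -[a]mulr1 -ba mulrA aba mul0r.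
  by rewrite a0 scale0r addr0.
have := dot3_orthogonal (vertex J) (vertex K) gg; rewrite !vg !dot3_vertex.
by move=> /fmorph_inj E; rewrite !adjE E.
Qed.

(** Acts on longitudes by lam -> alpha + e lam, where [C] and [S] are the cosine and sine of alpha,
    and fixes heights. *)
Definition lon_isometry (C S e : R) : 'M[R]_3 :=
  \matrix_(i < 3) (nth 0 [:: vec3 C S 0; vec3 (- (e * S)) (e * C) 0; e3] i).

Lemma mul_lon_isometry (C S e a b c : R) : vec3 a b c *m lon_isometry C S e
  = vec3 (a * C - e * (b * S)) (a * S + e * (b * C)) c.
Proof.
have mulE j : (vec3 a b c *m lon_isometry C S e) 0 j
    = a * vec3 C S 0 0 j + b * vec3 (- (e * S)) (e * C) 0 0 j + c * e3 0 j.
  rewrite mxE !big_ord_recl big_ord0 addr0 addrA.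
  by rewrite /lon_isometry ![(\matrix_(i < 3) _) _ _]mxE /= ![vec3 a b c _ _]mxE.
by apply: eq_vec3; rewrite mulE !vec3E; ring.
Qed.

Lemma lon_isometry_orthogonal C S e : C ^+ 2 + S ^+ 2 = 1 -> e ^+ 2 = 1 ->
  lon_isometry C S e *m (lon_isometry C S e)^T = 1%:M.
Proof.
move=> CS ee; pose r (k : nat) : 'rV[R]_3 :=
  nth 0 [:: vec3 C S 0; vec3 (- (e * S)) (e * C) 0; e3] k.
have eS : (e * S) ^+ 2 + (e * C) ^+ 2 = 1 by rewrite !exprMn ee !mul1r addrC.
apply/matrixP => i j; rewrite [RHS]mxE.
have -> : (lon_isometry C S e *m (lon_isometry C S e)^T) i j = dot3 (r i) (r j).
  by rewrite mxE; apply: eq_bigr => k _; rewrite !mxE.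
case: i => -[|[|[|//]]] lt_i; case: j => -[|[|[|//]]] lt_j;
  rewrite /r /= dot3E !vec3E ?mulr1n ?mulr0n.
- by rewrite -CS; ring.
- by ring.
- by ring.
- by ring.
- by rewrite -eS; ring.
- by ring.
- by ring.
- by ring.
- by ring.
Qed.

Lemma C6_symmetry_isometry (s : {perm letter}) C S e : C ^+ 2 + S ^+ 2 = 1 -> e ^+ 2 = 1 ->
  (forall J, cos (base_lon R (s J)) = cos (base_lon R J) * C - e * (sin (base_lon R J) * S) /\
    sin (base_lon R (s J)) = cos (base_lon R J) * S + e * (sin (base_lon R J) * C)) ->
  @C6_symmetry R s.
Proof.
move=> CS ee sE; exists (lon_isometry C S e); first exact: lon_isometry_orthogonal.
move=> J; rewrite !C6E; have [cJ sJ] := sE J.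
have vE t : (vertex J + t *: e3) *m lon_isometry C S e = vertex (s J) + t *: e3.
  rewrite mulmxDl -scalemxAl /vertex !mul_lon_isometry -cJ -sJ.
  by congr (_ + _ *: _); apply: eq_vec3; rewrite !vec3E; ring.
apply/seteqP; split=> v.
  by case=> _ [t _ <-] <-; exists t => //; rewrite vE.
by case=> t _ <-; exists (vertex J + t *: e3); [exists t|rewrite vE].
Qed.

Lemma letter_group_C6_symmetry s : s \in letter_group <-> @C6_symmetry R s.
Proof.
split=> [sG|/C6_symmetry_adj/letter_groupP//].
pose H := [set s | `[< @C6_symmetry R s >]]%SET.
have H_group : group_set H.
  apply/group_setP; split.
    rewrite inE; apply/asboolP; exists 1%:M; rewrite ?trmx1 ?mulmx1 // => J.
    by rewrite perm1; apply/seteqP; split=> v; [case=> w wJ <-|exists v => //]; rewrite mulmx1.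
  move=> r t rH tH; have /asboolP[g gg gE] : `[< @C6_symmetry R r >] by move: rH; rewrite inE.
  have /asboolP[h hh hE] : `[< @C6_symmetry R t >] by move: tH; rewrite inE.
  rewrite inE; apply/asboolP; exists (g *m h).
    by rewrite trmx_mul mulmxA -(mulmxA g) hh mulmx1.
  move=> J; rewrite permM -hE -gE; apply/seteqP; split=> v.
    case=> w wJ <-; exists (w *m g); last by rewrite mulmxA.
    by exists w.
  by case=> _ [w wJ <-] <-; exists w => //; rewrite mulmxA.
suff /fintype.subsetP/(_ s sG) : letter_group \subset Group H_group.
  by rewrite inE => /asboolP.
have s3 : Num.sqrt 3 ^+ 2 = 3 :> R by rewrite sqr_sqrtr.
have r12 : ratr (1 / 2) = 1 / 2 :> R by rewrite fmorph_div rmorph1 rmorph_nat.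
have lonE J := base_lonE R J.
have CS : (1 / 2) ^+ 2 + (Num.sqrt 3 / 2) ^+ 2 = 1 :> R.
  by rewrite (exprMn 2 (Num.sqrt 3)) s3; field.
rewrite gen_subG; apply/fintype.subsetP => t tS; rewrite inE; apply/asboolP.
move: tS; rewrite !inE => /orP[/orP[]|] /eqP ->.
(* Rotation by 2 pi / 3. *)
- apply: (@C6_symmetry_isometry _ (- (1 / 2)) (Num.sqrt 3 / 2) 1).
  + by rewrite sqrrN.
  + by rewrite expr1n.
  + move=> J; rewrite varpi_def; case: (lonE J) => -> ->.
    case: (lonE (match J with lA => lB | lB => lC | lC => lA | lD => lE | lE => lF | lF => lD end)) => -> ->.
    by case: J; rewrite /= ?rmorphN ?r12 ?rmorph1 ?rmorph0; split; field: s3.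
(* The reflection lam -> 2 pi / 3 - lam; on vertical lines it has the effect of the half-turn. *)
- apply: (@C6_symmetry_isometry _ (- (1 / 2)) (Num.sqrt 3 / 2) (- 1)).
  + by rewrite sqrrN.
  + by rewrite sqrrN expr1n.
  + move=> J; rewrite varrho_def; case: (lonE J) => -> ->.
    case: (lonE (match J with lA => lD | lB => lF | lC => lE | lD => lA | lE => lC | lF => lB end)) => -> ->.
    by case: J; rewrite /= ?rmorphN ?r12 ?rmorph1 ?rmorph0; split; field: s3.
(* The reflection lam -> pi / 3 - lam. *)
- apply: (@C6_symmetry_isometry _ (1 / 2) (Num.sqrt 3 / 2) (- 1)).
  + by [].
  + by rewrite sqrrN expr1n.
  + move=> J; rewrite varsigma_def; case: (lonE J) => -> ->.
    case: (lonE (match J with lA => lA | lB => lC | lC => lB | lD => lF | lE => lE | lF => lD end)) => -> ->.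
    by case: J; rewrite /= ?rmorphN ?r12 ?rmorph1 ?rmorph0; split; field: s3.
Qed.

End HexagonSymmetry.

Theorem proposition8 (R : realType) (x : rat) :
  0 < x -> x < 1 ->
  let xR : R := ratr x in
  let p : R := px xR in
  ~ (exists q : rat, p = ratr q) ->
  exists theta : angle -> R,
    (forall u, theta u != 0) /\
    exists E : letter -> letter -> nat -> expr p,
      [/\ taylor_expansion xR theta (fun _ _ => True) E,
          taylor_expansion xR theta keeps_A (fun J K k => erase_A (E J K k))
        & exists2 iota : {rmorphism Qring p -> Qring p},
            iota (Qgen p) = - Qgen p & restores_D6 iota E].
Proof.
move=> x_gt0 x_lt1 xR p p_irr.
exists (theta R x); split; first exact: theta_neq0.
have [iota iotaP iotaq] := Galois_exists (px_sqr R x_gt0) p_irr.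
exists (taylor_expr R x); split.
- exact: taylor_expansion_expr.
- exact: taylor_expansion_erase_A.
exists iota; first exact: iotaP.
split.
- split.
  + exact: preserves_varpi.
  + exact: preserves_varrho.
  + exact: preserves_varsigma.
- exists (operator iota); apply: operator_group_isoP.
  exact: (Galois_involutive (px_sqr R x_gt0) iotaP iotaq).
- exact: letter_group_dihedral.
- exact: letter_group_C6_symmetry.
Qed.
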